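(* Let $n\ge1$. Let $D$ be a weighted oriented cycle with underlying graph the cycle $C_{2n+1}=(x_1,\dots,x_{2n+1})$ such that all elements of $V^+$ are sinks, and suppose $V^+=\{x_v\}$ for some $x_v\in V(C_{2n+1})$. Let $\tilde I=I(D)$ be its edge ideal. Then $\mathrm{reg}\,\tilde I^{(s)}=\mathrm{reg}\,\tilde I^{\,s}$ for all $s\ge1$.
   Context: A weighted oriented graph $D=(V(D),E(D),w)$ consists of a finite simple graph $G$ (the underlying graph) with $V(G)=V(D)$, an orientation of each edge of $G$ (the pair $(x_i,x_j)\in E(D)$ denotes the edge directed from $x_i$ to $x_j$), and a weight function $w:V(D)\to\mathbb{N}=\{1,2,\dots\}$. If $x$ is a source (only arrows leaving $x$), one always assumes $w(x)=1$. Set $V^+=\{x\in V(D): w(x)\neq 1\}$. A vertex $x$ is a sink if all edges at $x$ are directed into $x$. Here $R=K[x_1,\dots,x_{2n+1}]$ with $K$ a field, with the standard grading (vertices are identified with variables). The edge ideal of $D$ is $I(D)=(x_ix_j^{w(x_j)} : (x_i,x_j)\in E(D))\subseteq R$. For a homogeneous ideal $I\subset R$, the $m$-th symbolic power is $I^{(m)}=\bigcap_{p\in \mathrm{Ass}(I)}(I^mR_p\cap R)$, the intersection being over all associated primes of $I$. $\mathrm{reg}$ denotes Castelnuovo–Mumford regularity: for a nonzero finitely generated graded $R$-module $M$, $\mathrm{reg}\,M=\max_{0\le i\le\dim M}\{a_i(M)+i\}$, where $a_i(M)=\max\{j\in\mathbb{Z}:[H^i_{\mathfrak m}(M)]_j\neq0\}$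 ($-\infty$ if $H^i_{\mathfrak m}(M)=0$) and $\mathfrak m=(x_1,\dots,x_{2n+1})$. *)

(* Defs.v *)
From HB Require Import structures.
From mathcomp Require Import all_boot all_order all_algebra.
From mathcomp Require Import mpoly.

Set Implicit Arguments.
Unset Strict Implicit.
Unset Printing Implicit Defensive.

Import Order.TTheory GRing.Theory Num.Theory.
Local Open Scope ring_scope.

(* Isolated vertices would count both as sources and as sinks; a cycle has
   none. *)
Record wograph (V : finType) := WOGraph {
  arc : rel V;
  weight : V -> nat;
  arc_asym : forall x y, arc x y -> ~~ arc y x;
  weight_gt0 : forall x, (0 < weight x)%N;
  weight_source : forall x, (forall y, ~~ arc y x) -> weight x = 1%N
}.

Definition is_sink (V : finType) (D : wograph V) (x : V) : Prop :=
  forall y, ~~ arc D x y.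

Definition Vplus (V : finType) (D : wograph V) : {set V} :=
  [set x | weight D x != 1%N].

Definition adj (V : finType) (D : wograph V) : rel V :=
  fun x y => arc D x y || arc D y x.

(* [ordS] is the successor modulo N. *)
Definition cycle_adj (N : nat) : rel 'I_N :=
  fun x y => (y == ordS x) || (x == ordS y).

Definition underlying_cycle (N : nat) (D : wograph 'I_N) : Prop :=
  forall x y, adj D x y = cycle_adj x y.

(* Ideals are represented by their (Prop-valued) membership predicates. *)
Section Ideals.
Variable R : comNzRingType.
Implicit Types (I J p : R -> Prop).

Definition is_ideal I : Prop :=
  [/\ I 0, forall a b, I a -> I b -> I (a + b) & forall a b, I b -> I (a * b)].

Definition ideal_gen (G : R -> Prop) : R -> Prop :=
  fun f => exists l : seq (R * R),
    (forall c, c \in l -> G c.2) /\ f = \sum_(c <- l) c.1 * c.2.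

Definition ideal_mul I J : R -> Prop :=
  ideal_gen (fun f => exists a b, [/\ I a, J b & f = a * b]).

Fixpoint ideal_pow I (m : nat) : R -> Prop :=
  if m is m'.+1 then ideal_mul I (ideal_pow I m') else fun _ => True.

Definition is_prime_ideal p : Prop :=
  [/\ is_ideal p, ~ p 1 & forall a b, p (a * b) -> p a \/ p b].

(* p is the annihilator of the class of some h in R/I. *)
Definition associated_prime I p : Prop :=
  is_prime_ideal p /\ exists h, forall g, p g <-> I (g * h).

(* J R_p \cap R, i.e. the f such that f/1 = a/g in R_p for some a in J and
   g outside p; the denominators t of the equality of fractions
   t (g f - a) = 0 can be absorbed in g and a. *)
Definition loc_contraction J p : R -> Prop :=
  fun f => exists2 g, ~ p g & J (g * f).

Definition symbolic_power I (m : nat) : R -> Prop :=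
  fun f => forall p, associated_prime I p -> loc_contraction (ideal_pow I m) p f.

End Ideals.

Definition edge_ideal (K : fieldType) (N : nat) (D : wograph 'I_N) :
    {mpoly K[N]} -> Prop :=
  ideal_gen (fun f => exists x y, arc D x y /\ f = 'X_x * 'X_y ^+ weight D y).
Arguments edge_ideal K {N} D.

(* Local cohomology H^i_m(I) of an ideal I of R = K[x_1..x_N], regarded as a
   graded R-module, with support in m = (x_1..x_N): cohomology of the Cech
   complex whose i-th term is the direct sum of the localizations I_(x_S) over
   the i-element sets S of variables, where x_S is the product of the variables
   in S. As R is a domain, these localizations are taken inside Frac R. *)
Section LocalCohomology.
Variables (K : fieldType) (N : nat).
Notation R := {mpoly K[N]}.
Implicit Types (I : R -> Prop) (S T : {set 'I_N}).

(* The degree is an integer, and 0 is homogeneous of every degree. *)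
Definition zhomog (j : int) (f : R) : Prop :=
  forall m, m \in msupp f -> (mdeg m)%:Z = j.

Definition varprod S : R := \prod_(x in S) 'X_x.

Definition loc_piece I S (j : int) (u : {fraction R}) : Prop :=
  exists (k : nat) (f : R),
    [/\ I f, zhomog (j + (k * #|S|)%:Z) f
      & u = tofrac f / tofrac (varprod S ^+ k)].

Definition cech_cochain I (i : nat) (j : int) (c : {set 'I_N} -> {fraction R}) :=
  forall S, #|S| = i -> loc_piece I S j (c S).

Definition cech_diff (c : {set 'I_N} -> {fraction R}) T : {fraction R} :=
  \sum_(x in T) (-1) ^+ #|[set y in T | (y < x)%N]| * c (T :\ x).

Definition cech_cocycle (i : nat) (c : {set 'I_N} -> {fraction R}) : Prop :=
  forall T, #|T| = i.+1 -> cech_diff c T = 0.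

(* For i = 0 the cochain b is unconstrained and unused: the only coboundary
   is 0. *)
Definition cech_coboundary I (i : nat) (j : int)
    (c : {set 'I_N} -> {fraction R}) : Prop :=
  exists b : {set 'I_N} -> {fraction R},
    (forall S, #|S|.+1 = i -> loc_piece I S j (b S)) /\
    (forall T, #|T| = i -> c T = cech_diff b T).

(* [H^i_m(I)]_j <> 0 *)
Definition lc_neq0 I (i : nat) (j : int) : Prop :=
  exists c, [/\ cech_cochain I i j c, cech_cocycle i c
              & ~ cech_coboundary I i j c].

Definition is_max (A : int -> Prop) (a : int) : Prop :=
  A a /\ forall b, A b -> b <= a.

(* a_i(I) = a, in the case H^i_m(I) <> 0; otherwise a_i(I) = -oo, and no
   integer a satisfies the predicate. *)
Definition is_a_invariant I (i : nat) (a : int) : Prop := is_max (lc_neq0 I i) a.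

(* reg I = r, for I a nonzero homogeneous ideal. Then dim I = N, since I is
   a nonzero submodule of the domain R. The first clause says that no a_i(I)
   is +oo. *)
Definition is_reg I (r : int) : Prop :=
  (forall i, (i <= N)%N -> (exists j, lc_neq0 I i j) ->
     exists a, is_a_invariant I i a) /\
  is_max (fun t => exists i a,
     [/\ (i <= N)%N, is_a_invariant I i a & t = a + i%:Z]) r.

End LocalCohomology.

(* Main.v *)
(* For every variable x_i, the ordinary power I^s and the symbolic power I^(s)
   become equal after inverting x_i; hence they have the same local cohomology
   in cohomological degrees i >= 2, and only H^1, that is, sat(I^s)/I^s, may
   differ.  Write w for the weight of x_v, and b_i for the exponent of x_i in a
   monomial, divided by the weight of x_i and rounded down.  By Konig-type
   duality on a cycle, a monomial lies in I^s as soon as every vertex cover has b-weight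
   at least s and b has total weight at least 2s.  The monomials of the
   saturation satisfy the first condition, so those outside I^s fail the second
   one and have degree less than s(w + 1).  On the other hand an explicit Cech
   class in cohomological degree i >= 2 and internal degree j with
   i + j = s(w + 1) shows that H^1 does not contribute to the regularity of
   either power. *)
Require Import Defs.
From Stdlib Require Import Classical.
From HB Require Import structures.
From mathcomp Require Import all_boot all_order all_algebra.
From mathcomp Require Import mpoly.
From mathcomp Require Import zify ring.

Set Implicit Arguments.
Unset Strict Implicit.
Unset Printing Implicit Defensive.

Import Order.TTheory GRing.Theory Num.Theory.
Local Open Scope ring_scope.

(** * Matchings and covers of a cycle *)

Section PathKonig.
Local Open Scope nat_scope.

(* Greedy matching: saturating the first edge leaves a path with one vertex
   less, whose first capacity is [b 1 - b 0] (zero if truncated). *)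
Lemma path_konig (p : nat) (b : nat -> nat) :
  exists (y : nat -> nat) (C : pred nat),
    [/\ (y 0 <= b 0),
        forall k, (k < p) -> (y k + y k.+1 <= b k.+1),
        y p = 0%N,
        forall k, (k < p) -> C k || C k.+1
      & (\sum_(k < p.+1) C k * b k <= \sum_(k < p) y k)].
Proof.
elim: p b => [|p IHp] b.
  exists (fun=> 0%N), pred0; split=> //.
  by rewrite big_ord_recr !big_ord0.
pose b' k := if k is 0 then (b 1 - b 0) else b k.+1.
have [y [C [y0 yS yp Ccov leCy]]] := IHp b'.
pose y1 k := if k is k'.+1 then y k' else minn (b 0) (b 1).
(* Exactly one of the vertices 0 and 1 is taken, at the cost of [minn (b 0) (b 1)] plus the
   [b']-price of [C 0]. *)
pose C1 k := match k with
  | 0 => (b 0 <= b 1) && ~~ C 0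
  | 1 => (b 1 < b 0) || C 0
  | k'.+2 => C k'.+1 end.
exists y1, C1; split=> //.
- by rewrite /= geq_minl.
- case=> [|k] lt_kp /=; first by move: y0; rewrite /b'; lia.
  by have := yS k lt_kp; rewrite /b'.
- case=> [|[|k]] lt_kp /=.
  + by case: leqP; case: (C 0).
  + by have:= Ccov 0 lt_kp; case: (C 0) => /= [_|->]; rewrite !orbT.
  + exact: Ccov.
have -> : \sum_(k < p.+2) C1 k * b k =
    C1 0 * b 0 + (C1 1 * b 1 + \sum_(k < p) C k.+1 * b k.+2).
  by rewrite !big_ord_recl.
have -> : \sum_(k < p.+1) y1 k = minn (b 0) (b 1) + \sum_(k < p) y k.
  by rewrite big_ord_recl.
have := leCy; have -> : \sum_(k < p.+1) C k * b' k =
    C 0 * (b 1 - b 0) + \sum_(k < p) C k.+1 * b k.+2.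
  by rewrite big_ord_recl.
by rewrite /= /minn; case: (C 0); case: (ltngtP (b 0) (b 1)) => /=; lia.
Qed.

End PathKonig.

Section CycleMatching.
Local Open Scope nat_scope.
Variables (p s : nat) (b : nat -> nat).

Definition path_cover (C : pred nat) :=
  forall k, (k < p) -> C k || C k.+1.

Definition cover_weight (C : pred nat) := (\sum_(k < p.+1) C k * b k).

(* If some vertex [k] is missed by both covers, then both contain its
   neighbours, and exchanging the covers beyond [k] gives two covers of the
   cycle. *)
Lemma cover_weight_swap (C0 C2 : pred nat) :
    (forall C, path_cover C -> C p || C 0 -> (s <= cover_weight C)) ->
    (s.*2 <= \sum_(k < p.+1) b k) ->
    path_cover C0 -> path_cover C2 -> C2 0 -> C2 p ->
  (s.*2 <= cover_weight C0 + cover_weight C2).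
Proof.
move=> cov_s sum_s cov0 cov2 C20 C2p.
case: (classic (exists2 k, (k <= p) & ~~ C0 k && ~~ C2 k)); last first.
  move=> all_cov; apply: leq_trans sum_s _; rewrite -big_split /=.
  apply: leq_sum => k _; rewrite -mulnDl -[leqLHS]mul1n leq_mul2r.
  apply/orP; right; case C0k: (C0 k) => //; case C2k: (C2 k) => //.
  by case: all_cov; exists (k : nat); rewrite ?C0k ?C2k // -ltnS.
case=> k le_kp /andP[nC0k nC2k].
pose C' i := if (i <= k) then C0 i else C2 i.
pose C'' i := if (i <= k) then C2 i else C0 i.
have k_gt0 : (0 < k) by case: k nC2k {le_kp nC0k C' C''} => //; rewrite C20.
have lt_kp : (k < p).
  by rewrite ltn_neqAle le_kp andbT; apply: contraNneq nC2k => ->.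
have s' : (s <= cover_weight C').
  apply: cov_s => [i lt_ip|]; rewrite /C'; last by rewrite leqNgt lt_kp C2p.
  case: (ltngtP i k) => [_|lt_ki|->]; [exact: cov0|exact: cov2|].
  by have := cov2 _ lt_kp; rewrite (negPf nC2k) /= => ->; rewrite orbT.
have s'' : (s <= cover_weight C'').
  apply: cov_s => [i lt_ip|]; rewrite /C''; last by rewrite C20 orbT.
  case: (ltngtP i k) => [_|lt_ki|->]; [exact: cov2|exact: cov0|].
  by have := cov0 _ lt_kp; rewrite (negPf nC0k) /= => ->; rewrite orbT.
rewrite -addnn; apply: leq_trans (leq_add s' s'') _.
rewrite /cover_weight -!big_split /=; apply: leq_sum => i _.
by rewrite /C' /C''; case: ifP => _; rewrite // addnC.
Qed.

(* The closing edge gets the least multiplicity [t] that does not rule out a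
   matching of size [s] on account of the covers missing both of its ends; the
   path left over is then handled by [path_konig].
   Edge [k] joins [k] and [k.+1]; the closing edge [p] joins [p] and [0]. *)
Lemma cycle_matching :
    (0 < p) ->
    (forall C, path_cover C -> C p || C 0 -> (s <= cover_weight C)) ->
    (s.*2 <= \sum_(k < p.+1) b k) ->
  exists y : nat -> nat,
    [/\ (s <= \sum_(k < p.+1) y k), (y 0 + y p <= b 0)
      & forall k, (k < p) -> (y k + y k.+1 <= b k.+1)].
Proof.
move=> p_gt0 cov_s sum_s.
pose Q t := forall C, path_cover C -> ~~ C 0 -> ~~ C p ->
  (s <= t + cover_weight C).
have [t Qt t_min] : exists2 t, Q t & t = 0%N \/ exists C0,
    [/\ path_cover C0, ~~ C0 0, ~~ C0 p & (t + cover_weight C0 <= s)].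
  have: Q s by move=> C *; apply: leq_addr.
  (* Descend from [t = s], where the bound is trivial; the first failure supplies a cover that is
     tight for [t]. *)
  elim: {-2}s => [|t IHt] Qt; first by exists 0%N; last left.
  case: (classic (Q t)) => [|nQt]; first exact: IHt.
  exists t.+1 => //; right; apply: NNPP => nex; apply: nQt => C covC C0 Cp.
  rewrite leqNgt; apply/negP => lt_s; apply: nex; exists C; split=> //.
have indic (q : nat) (C : pred nat) : (q <= p) -> ~~ C q ->
    (cover_weight (fun k => C k || (k == q)) = cover_weight C + b q).
  move=> le_qp nCq; have lt_qp : (q < p.+1) by [].
  rewrite /cover_weight (bigD1 (Ordinal lt_qp)) //=.
  rewrite [in RHS](bigD1 (Ordinal lt_qp)) //=.
  rewrite (negPf nCq) eqxx /= mul1n add0n addnC; congr (_ + _).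
  apply: eq_bigr => i /eqP ne_iq; case: eqP => [eq_iq|]; last by rewrite orbF.
  by case: ne_iq; apply: val_inj.
(* Adding one end [q] to a tight cover [C0] also covers the closing edge, so [t + cover_weight C0 <=
   s <= cover_weight C0 + b q]. *)
have le_t q : (q == 0) || (q == p) -> (t <= b q).
  move=> end_q; case: t_min => [-> //|[C0 [cov0 nC0 nCp]]].
  have le_qp : (q <= p) by case/orP: end_q => /eqP->.
  have nCq : ~~ C0 q by case/orP: end_q => /eqP->.
  have /cov_s : path_cover (fun k => C0 k || (k == q)).
    by move=> k /cov0 /orP[]->; rewrite ?orbT.
  have -> : (C0 p || (p == q)) || (C0 0 || (0 == q)).
    by case/orP: end_q => /eqP->; rewrite eqxx ?orbT.
  by move=> /(_ isT); rewrite indic //; lia.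
pose b' k := (if (k == 0) || (k == p) then b k - t else b k).
have w_eq (C : pred nat) : (cover_weight C =
    \sum_(k < p.+1) C k * b' k + C 0 * t + C p * t).
  rewrite /cover_weight; move: p_gt0 le_t @b'; case: (p) => // q _ le_t b'.
  rewrite !(big_ord_recl q.+1) !(big_ord_recr q) /= /bump /= !add1n.
  have le0 : (t <= b 0) by apply: le_t.
  have leq : (t <= b q.+1) by apply: le_t; rewrite eqxx orbT.
  have -> : b' 0 = (b 0 - t) by [].
  have -> : b' q.+1 = (b q.+1 - t) by rewrite /b' eqxx orbT.
  set X := (\sum_(i < q) _); set Y := (\sum_(i < q) C _ * b' _).
  have -> : Y = X.
    apply: eq_bigr => i _; rewrite /b' /= /bump /= !add1n eqSS.
    by rewrite ltn_eqF // ltn_ord.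
  by case: (C 0); case: (C q.+1); lia.
have [y [C [y0 yS yp Ccov leCy]]] := path_konig p b'.
exists (fun k => if k == p then t else y k); split.
- rewrite big_ord_recr /= eqxx.
  have -> : (\sum_(i < p) (if val i == p then t else y i) = \sum_(i < p) y i).
    by apply: eq_bigr => i _; rewrite ltn_eqF // ltn_ord.
  (* Passing to [b'] saves [t] for each end in [C]. With one end the hypothesis on covers suffices,
     with none [Q t]; with both, either [t] is 0 or the swap with a tight cover makes up for the
     second [t]. *)
  suff: (s <= \sum_(k < p.+1) C k * b' k + t) by lia.
  have := w_eq C.
  case C0: (C 0); case Cp: (C p); rewrite ?mul1n ?mul0n => wC.
  + case: t_min => [t0|[D0 [covD nD0 nDp]]].
      by have := cov_s C Ccov; rewrite Cp => /(_ isT); lia.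
    have := cover_weight_swap cov_s sum_s covD Ccov C0 Cp; lia.
  + by have := cov_s C Ccov; rewrite C0 orbT => /(_ isT); lia.
  + by have := cov_s C Ccov; rewrite Cp => /(_ isT); lia.
  + by have := Qt C Ccov; rewrite C0 Cp => /(_ isT isT); lia.
- rewrite eqxx eq_sym gtn_eqF //.
  have := le_t 0%N isT; move: y0; rewrite /b' eqxx /=; lia.
move=> k lt_kp; rewrite ltn_eqF //.
have := yS k lt_kp; case: eqP => [->|_]; rewrite /b' ?eqxx /=.
  rewrite yp; have := le_t p; rewrite eqxx orbT => /(_ isT); lia.
by case: ifP; lia.
Qed.
End CycleMatching.

(** * Powers of the edge ideal in terms of exponents *)

Section EdgeMonomials.
Local Open Scope nat_scope.
Variables (p : nat) (w : 'I_p.+1 -> nat).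
Hypothesis w_gt0 : forall x, 0 < w x.
Implicit Types (m d : 'X_{1..p.+1}) (C : {set 'I_p.+1}).

(** The tails of arcs will all have weight 1, so the generator of an edge can be written
    symmetrically in its ends, without the orientation. *)
Definition edge_mon (x : 'I_p.+1) : 'X_{1..p.+1} :=
  [multinom w z * ((x == z) + (ordS x == z)) | z < p.+1].

Fixpoint in_pow s m : Prop :=
  if s is s'.+1 then exists x m', m = (edge_mon x + m')%MM /\ in_pow s' m'
  else True.

Definition vertex_cover C := [forall x, (x \in C) || (ordS x \in C)].

Definition cap m z := m z %/ w z.

Lemma in_powD s m d : in_pow s m -> in_pow s (m + d)%MM.
Proof.
elim: s m => //= s IHs m [x [m' [-> /IHs m'_in]]].
by exists x, (m' + d)%MM; rewrite addmA.
Qed.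

Lemma in_pow_le s m m' : in_pow s m -> (m <= m')%MM -> in_pow s m'.
Proof. by move=> m_in /submK <-; rewrite addmC; apply: in_powD. Qed.

Lemma in_powS s m : in_pow s.+1 m -> in_pow s m.
Proof. by case=> x [m' [-> m'_in]]; rewrite addmC; apply: in_powD. Qed.

Lemma in_powW s t m : t <= s -> in_pow s m -> in_pow t m.
Proof. by move/subnK<-; elim: (s - t) => // k IHk /in_powS. Qed.

Lemma in_pow_muln x s : in_pow s (edge_mon x *+ s)%MM.
Proof.
by elim: s => //= s IHs; exists x, (edge_mon x *+ s)%MM; rewrite mulmS.
Qed.

Lemma capD x m z :
  cap (edge_mon x + m)%MM z = (x == z) + (ordS x == z) + cap m z.
Proof. by rewrite /cap mnmDE mnmE mulnC divnMDl. Qed.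

(** By [capD], each edge factor adds one to the capacity of both its ends, and a cover contains one
    of them. *)
Lemma in_pow_cover s m C :
  vertex_cover C -> in_pow s m -> s <= \sum_(z in C) cap m z.
Proof.
move/forallP=> covC; elim: s m => //= s IHs m [x [m' [-> /IHs le_s]]].
under eq_bigr do rewrite capD; rewrite big_split /= -add1n leq_add //.
have /orP[xC|xC] := covC x; rewrite (bigD1 _ xC) /= eqxx ?addn1 //.
Qed.

(** The exponents of an edge monomial are at most [W], so a product of [s] of them never needs an
    exponent above [s * W]. *)
Lemma in_pow_trunc W s m m' :
    (forall z, (w z).*2 <= W) -> in_pow s m ->
  (forall z, minn (m z) (s * W) <= m' z) -> in_pow s m'.
Proof.
move=> leW; elim: s m m' => //= s IHs m m' [x [m1 [-> m1_in]]] le_m'.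
have e_le z : edge_mon x z <= W.
  rewrite mnmE (leq_trans _ (leW z)) // -muln2 leq_mul2l; apply/orP; right.
  by do 2!case: eqP.
have e_le' : (edge_mon x <= m')%MM.
  apply/mnm_lepP => z; have := le_m' z; have := e_le z.
  rewrite mnmDE mulSn; lia.
exists x, (m' - edge_mon x)%MM; split; first by rewrite addmC submK.
apply: IHs m1_in _ => z; have := le_m' z; have := e_le z.
by rewrite mnmBE mnmDE mulSn; lia.
Qed.

(** Take the edge from [z] to [ordS z] with multiplicity [y z]; the vertex [z] then lies only on the
    edges indexed by [z] and [ord_pred z]. *)
Lemma matching_in_pow (y : 'I_p.+1 -> nat) m :
    (forall z, (y z + y (ord_pred z)) * w z <= m z) ->
  in_pow (\sum_z y z) m.
Proof.
move=> fits; suff: in_pow (\sum_z y z) (\sum_x edge_mon x *+ y x)%MM.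
  move/in_pow_le; apply; apply/mnm_lepP => z; apply: leq_trans (fits z).
  rewrite mnm_sumE; under eq_bigr do rewrite mulmnE mnmE -mulnA mulnDl.
  rewrite -big_distrr /= mulnC leq_mul2r big_split /=; apply/orP; right.
  apply: leq_add.
    rewrite (bigD1 z) //= eqxx mul1n big1 ?addn0 // => x /negPf ne_xz.
    by rewrite ne_xz.
  rewrite (bigD1 (ord_pred z)) //= ord_predK eqxx mul1n big1 ?addn0 // => x.
  by case: (ordS x =P z) => [<-|//]; rewrite ordSK eqxx.
elim/big_rec2: _ => // x m1 s1 _.
elim: (y x) => [|k IHk] /= s1_in; first by rewrite mulm0n add0m.
exists x, (edge_mon x *+ k + m1)%MM; split; last exact: IHk.
by rewrite addmA mulmS.
Qed.

(** A matching within the capacities needs exponents at most [cap m z * w z <= m z], so the duality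
    on the cycle yields [s] edge factors. *)
Lemma cover_in_pow s m :
    0 < p ->
    (forall C, vertex_cover C -> s <= \sum_(z in C) cap m z) ->
    s.*2 <= \sum_z cap m z ->
  in_pow s m.
Proof.
move=> p_gt0 cov_s sum_s; pose b k := cap m (inord k).
have [||y [sum_y y0 yS]] := @cycle_matching p s b p_gt0.
- move=> C covC end_C; pose C' : {set 'I_p.+1} := [set x : 'I_p.+1 | C x].
  have /cov_s : vertex_cover C'.
    apply/forallP => x; rewrite !inE; case: (ltngtP x p) => [lt_xp|lt_px|xp].
    - by have:= covC _ lt_xp; rewrite /= modn_small.
    - by have := ltn_ord x; rewrite ltnS leqNgt lt_px.
    - by rewrite /= xp modnn.
  rewrite big_mkcond /cover_weight /=; move/leq_trans; apply.
  apply: leq_sum => x _; rewrite inE /b inord_val.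
  by case: (C x); rewrite ?mul1n ?mul0n.
- by apply: leq_trans sum_s _; apply: leq_sum => x _; rewrite /b inord_val.
apply: in_powW sum_y _; apply: (@matching_in_pow (fun z => y z)) => z.
apply: leq_trans (leq_trunc_div (m z) (w z)).
rewrite leq_mul2r; apply/orP; right.
case: z => -[|k] lt_z; rewrite /= ?add0n.
  rewrite modn_small // (leq_trans y0) // /b /cap.
  by rewrite (_ : inord 0 = Ordinal lt_z) //; apply: val_inj; rewrite /= inordK.
rewrite modnDr modn_small; last exact: ltnW.
have /leq_trans -> // : y k.+1 + y k <= b k.+1 by rewrite addnC yS.
rewrite /b /cap.
rewrite (_ : inord k.+1 = Ordinal lt_z) //.
by apply: val_inj; rewrite /= inordK.
Qed.

End EdgeMonomials.

(** * Ordinary and symbolic powers of the edge ideal *)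

Section IdealGen.
Variable R : comNzRingType.
Implicit Types (I G : R -> Prop).

Lemma ideal_gen_ideal G : is_ideal (ideal_gen G).
Proof.
split=> [|a b [la [Ga ->]] [lb [Gb ->]]|a b [l [Gl ->]]].
- by exists [::]; split=> //; rewrite big_nil.
- exists (la ++ lb); split; last by rewrite big_cat.
  by move=> c; rewrite mem_cat => /orP[/Ga|/Gb].
exists [seq (a * c.1, c.2) | c <- l]; split=> [c /mapP[c' /Gl ? ->] //|].
by rewrite big_map mulr_sumr; apply: eq_bigr => c _; rewrite mulrA.
Qed.

Lemma mem_ideal_gen G g : G g -> ideal_gen G g.
Proof.
move=> Gg; exists [:: (1, g)]; split; last by rewrite big_seq1 mul1r.
by move=> c /[1!inE] /eqP->.
Qed.

Lemma ideal_gen_sub G I :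
  is_ideal I -> (forall g, G g -> I g) -> forall f, ideal_gen G f -> I f.
Proof.
case=> I0 ID IM GI f [l [Gl ->]]; elim: l Gl => [|c l IHl] Gl.
  by rewrite big_nil.
rewrite big_cons; apply: ID; first by apply/IM/GI/Gl/mem_head.
by apply: IHl => c' c'l; apply: Gl; rewrite inE c'l orbT.
Qed.

Lemma ideal_pow_ideal I s : is_ideal (ideal_pow I s).
Proof. by case: s => [|s] //=; apply: ideal_gen_ideal. Qed.

Lemma ideal_powS I s a b : I a -> ideal_pow I s b -> ideal_pow I s.+1 (a * b).
Proof. by move=> Ia Ib; apply: mem_ideal_gen; exists a, b. Qed.

Lemma ideal_pow_symbolic I s f : ideal_pow I s f -> symbolic_power I s f.
Proof. by move=> If q [[_ q1 _] _]; exists 1; rewrite ?mul1r. Qed.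
End IdealGen.

(** * Monomial ideals and components of lowest degree *)

Section MonomialIdeal.
Variables (K : fieldType) (N : nat).
Implicit Types (A : 'X_{1..N} -> Prop) (f g : {mpoly K[N]}).

Definition mono_ideal A f := forall m, m \in msupp f -> A m.

Lemma msuppM_ex f g m :
  m \in msupp (f * g) ->
  exists m1 m2, [/\ m1 \in msupp f, m2 \in msupp g & m = (m1 + m2)%MM].
Proof. by move/msuppM_le/allpairsP => [[m1 m2] [? ? ->]]; exists m1, m2. Qed.

Lemma mono_ideal_ideal A :
  (forall m d, A m -> A (m + d)%MM) -> is_ideal (mono_ideal A).
Proof.
move=> upA; split=> [m|f g Af Ag m|f g Ag m].
- by rewrite msupp0.
- by move/msuppD_le; rewrite mem_cat => /orP[/Af|/Ag].
by case/msuppM_ex=> m1 [m2 [_ /Ag Am2 ->]]; rewrite addmC; apply: upA.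
Qed.

Lemma mono_idealX A m : A m -> mono_ideal A 'X_[m].
Proof. by move=> Am m'; rewrite msuppX inE => /eqP->. Qed.

Lemma mono_ideal_sub A (I : {mpoly K[N]} -> Prop) :
  is_ideal I -> (forall m, A m -> I 'X_[m]) -> forall f, mono_ideal A f -> I f.
Proof.
case=> I0 ID IM AI f; rewrite /mono_ideal [in I _](mpolyE f).
elim: (msupp f) => [|m l IHl] Af; first by rewrite big_nil.
rewrite big_cons; apply: ID.
  by rewrite -mul_mpolyC; apply/IM/AI/Af/mem_head.
by apply: IHl => m' m'l; apply: Af; rewrite inE m'l orbT.
Qed.

Lemma mem_msuppMX m d f : ((m + d)%MM \in msupp (f * 'X_[d])) = (m \in msupp f).
Proof. by rewrite !mcoeff_msupp addmC mcoeffMX. Qed.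

Lemma msuppMX_ex f d m :
  m \in msupp (f * 'X_[d]) -> exists2 m', m' \in msupp f & m = (m' + d)%MM.
Proof.
by case/msuppM_ex=> m' [d' [m'f /[1!msuppX]/[1!inE]/eqP-> ->]]; exists m'.
Qed.

Definition mpart (P : pred 'X_{1..N}) f :=
  \sum_(m <- msupp f | P m) f@_m *: 'X_[m].

Lemma mcoeff_mpart P f m : (mpart P f)@_m = if P m then f@_m else 0.
Proof.
rewrite /mpart raddf_sum /=; case: (boolP (m \in msupp f)) => [mf|nmf].
  rewrite big_mkcond (bigD1_seq m) //= big1 ?addr0.
    by case: (P m); rewrite // mcoeffZ mcoeffX eqxx mulr1.
  move=> m' /negPf ne_m'm; case: (P m'); rewrite // mcoeffZ mcoeffX.
  by rewrite ne_m'm mulr0.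
rewrite (memN_msupp_eq0 nmf) if_same big_seq_cond big1 // => m' /andP[m'f _].
rewrite mcoeffZ mcoeffX; case: eqP => [eq_m|]; last by rewrite mulr0.
by rewrite -eq_m m'f in nmf.
Qed.

(* The product of the components of lowest [phi]-degree is not zero and is
   not cancelled by the remaining terms of [f * g]. *)
Lemma msupp_lowestM (phi : 'X_{1..N} -> nat) f g :
    {morph phi : m d / (m + d)%MM >-> (m + d)%N} ->
    f != 0 -> g != 0 ->
  exists mf mg, [/\ mf \in msupp f, mg \in msupp g,
    (mf + mg)%MM \in msupp (f * g),
    (forall m, m \in msupp f -> (phi mf <= phi m)%N)
  & (forall m, m \in msupp g -> (phi mg <= phi m)%N)].
Proof.
move=> phiD nz_f nz_g.
have eq_low (a b c d : nat) :
  (c <= a)%N -> (d <= b)%N -> (a + b = c + d)%N -> a = c /\ b = d by lia.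
have low (h : {mpoly K[N]}) : h != 0 -> exists2 m0, m0 \in msupp h &
    forall m, m \in msupp h -> (phi m0 <= phi m)%N.
  rewrite -msupp_eq0; elim: (msupp h) => // m l IHl _.
  have [->|/IHl [m0 m0l m0_min]] := eqVneq l [::].
    by exists m => [|m']; rewrite !inE // => /eqP->.
  have [le_m0|lt_m] := leqP (phi m0) (phi m).
    exists m0 => [|m']; rewrite !inE ?m0l ?orbT //.
    by case/orP=> [/eqP->|/m0_min].
  exists m => [|m']; rewrite !inE ?eqxx //; case/orP=> [/eqP->//|/m0_min].
  exact/leq_trans/ltnW.
have [af af_f af_min] := low f nz_f; have [ag ag_g ag_min] := low g nz_g.
pose f0 := mpart (fun m => phi m == phi af) f.
pose g0 := mpart (fun m => phi m == phi ag) g.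
have nz_f0 : f0 != 0.
  by apply: contraTneq af_f => f0E; rewrite mcoeff_msupp negbK;
    move: (mcoeff0 K af); rewrite -f0E mcoeff_mpart eqxx => ->.
have nz_g0 : g0 != 0.
  by apply: contraTneq ag_g => g0E; rewrite mcoeff_msupp negbK;
    move: (mcoeff0 K ag); rewrite -g0E mcoeff_mpart eqxx => ->.
have in_part (h : {mpoly K[N]}) m0 m :
    m \in msupp (mpart (fun m => phi m == phi m0) h) ->
    m \in msupp h /\ phi m = phi m0.
  rewrite !mcoeff_msupp mcoeff_mpart.
  by case: (phi m =P _) => [-> //|_]; rewrite eqxx.
have := mulf_neq0 nz_f0 nz_g0; rewrite -msupp_eq0.
case supp_fg: (msupp (f0 * g0)) => [//|m l] _.
have m_fg : m \in msupp (f0 * g0) by rewrite supp_fg mem_head.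
have [mf [mg [mf_f mg_g mE]]] := msuppM_ex m_fg.
have [mf_f' phi_mf] := in_part _ _ _ mf_f.
have [mg_g' phi_mg] := in_part _ _ _ mg_g.
exists mf, mg; rewrite phi_mf phi_mg; split=> //.
move: m_fg; rewrite -mE !mcoeff_msupp.
have -> // : (f0 * g0)@_m = (f * g)@_m.
rewrite !mcoeffM; apply: eq_bigr => -[k1 k2] /= /eqP mk.
rewrite !mcoeff_mpart.
have phi_k : (phi k1 + phi k2 = phi af + phi ag)%N.
  by rewrite -phiD -mk mE phiD phi_mf phi_mg.
have [k1f|/memN_msupp_eq0->] := boolP (bmnm k1 \in msupp f); last first.
  by rewrite if_same !mul0r.
have [k2g|/memN_msupp_eq0->] := boolP (bmnm k2 \in msupp g); last first.
  by rewrite if_same !mulr0.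
have [-> ->] := eq_low _ _ _ _ (af_min _ k1f) (ag_min _ k2g) phi_k.
by rewrite !eqxx.
Qed.
End MonomialIdeal.

Lemma ordS_neq p (x : 'I_p.+1) : (0 < p)%N -> ordS x != x.
Proof.
move=> p_gt0; apply/eqP => /(congr1 val) /=.
have [le_px|lt_xp] := leqP p x; last by rewrite modn_small //; lia.
have -> : val x = p by have := ltn_ord x; rewrite /=; lia.
by rewrite modnn => p0; rewrite -p0 in p_gt0.
Qed.

(** * Vertex covers, associated primes and symbolic powers *)

Section EdgeIdeal.
Variables (K : fieldType) (p : nat) (D : wograph 'I_p.+1).
Hypothesis p_gt0 : (0 < p)%N.
Hypothesis D_cycle : underlying_cycle D.
Hypothesis tail_weight : forall x y, Defs.arc D x y -> weight D x = 1%N.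

Notation w := (weight D).
Notation I := (edge_ideal K D).
Implicit Types (f g : {mpoly K[p.+1]}) (C : {set 'I_p.+1}).

Lemma edge_generatorP f :
  (exists x y, Defs.arc D x y /\ f = 'X_x * 'X_y ^+ w y) <->
  exists z, f = 'X_[edge_mon w z].
Proof.
have genE x y : Defs.arc D x y -> 'X_x * 'X_y ^+ w y =
    'X_[[multinom w z * ((x == z) + (y == z)) | z < p.+1]] :> {mpoly K[p.+1]}.
  move=> /tail_weight wx; rewrite mpolyXn -mpolyXD; congr 'X_[_].
  apply/mnmP => z; rewrite mnmDE mulmnE !mnm1E mnmE mulnDr ![(w z * _)%N]mulnC.
  by congr (_ + _)%N; case: eqP => [<-|]; rewrite ?wx.
split=> [[x [y [xy ->]]]|[z ->]].
  have : adj D x y by rewrite /adj xy.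
  rewrite D_cycle genE // => /orP[] /eqP->; [exists x | exists y] => //.
  by congr 'X_[_]; apply/mnmP => z; rewrite !mnmE [in RHS]addnC.
have : adj D z (ordS z) by rewrite D_cycle /cycle_adj eqxx.
case/orP=> zS; [exists z, (ordS z) | exists (ordS z), z].
  by rewrite genE.
split; rewrite ?genE //.
by congr 'X_[_]; apply/mnmP => x; rewrite !mnmE [in RHS]addnC.
Qed.

Lemma edge_ideal_edge z : I 'X_[edge_mon w z].
Proof. by apply/mem_ideal_gen/edge_generatorP; exists z. Qed.

Lemma in_pow_ideal s : is_ideal (@mono_ideal K p.+1 (in_pow w s)).
Proof. by apply: mono_ideal_ideal => m d; apply: in_powD. Qed.

Lemma ideal_powP s f : ideal_pow I s f <-> mono_ideal (in_pow w s) f.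
Proof.
split; last first.
  move: f; apply: mono_ideal_sub; first exact: ideal_pow_ideal.
  elim: s => //= s IHs m [x [m' [-> /IHs Im']]]; rewrite mpolyXD.
  by apply: ideal_powS => //; apply: edge_ideal_edge.
elim: s f => [|s IHs] f; first by move=> _ m _.
apply: ideal_gen_sub; first exact: in_pow_ideal.
move=> _ [a [b [Ia /IHs b_in ->]]].
have [I0 ID IM] := in_pow_ideal s.+1.
move: a Ia; apply: ideal_gen_sub.
  split=> [|a1 a2 I1 I2|a1 a2 I2]; rewrite ?mul0r ?mulrDl -?mulrA //.
    exact: ID.
  exact: IM.
move=> _ /edge_generatorP [z ->] m; rewrite mulrC.
by case/msuppMX_ex=> m' /b_in m'_in ->; exists z, m'; rewrite addmC.
Qed.

(** The ideal generated by the variables in [C], described by its monomials. *)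
Definition cover_prime C f :=
  mono_ideal (fun m : 'X_{1..p.+1} => [exists x in C, (0 < m x)%N]) f.

Lemma cover_prime_ideal C : is_ideal (cover_prime C).
Proof.
apply: mono_ideal_ideal => m d /exists_inP[x xC m_x]; apply/exists_inP.
by exists x; rewrite // mnmDE addn_gt0 m_x.
Qed.

Lemma not_cover_prime C f :
  ~ cover_prime C f ->
  exists2 m, m \in msupp f & forall x, x \in C -> m x = 0%N.
Proof.
move=> nCf.
have /allPn[m mf nCm] :
    ~~ all (fun m : 'X_{1..p.+1} => [exists x in C, (0 < m x)%N]) (msupp f).
  by apply/negP => /allP Cf; apply: nCf.
exists m => // x xC; apply/eqP; rewrite -leqn0 leqNgt; apply: contra nCm => m_x.
by apply/exists_inP; exists x.
Qed.

Lemma cover_degD C :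
  {morph (fun m : 'X_{1..p.+1} => \sum_(x in C) m x)%N : m d
    / (m + d)%MM >-> (m + d)%N}.
Proof.
by move=> m d /=; rewrite -big_split; apply: eq_bigr => x _; rewrite mnmDE.
Qed.

Lemma not_cover_prime_neq0 C f : ~ cover_prime C f -> f != 0.
Proof.
by case/not_cover_prime=> m mf _; apply: contraTneq mf => ->; rewrite msupp0.
Qed.

(** Outside the ideal means having a monomial of degree 0 in the variables of [C]. Lowest components
    for this degree do not cancel in a product, so the product has such a monomial too. *)
Lemma cover_prime_prime C : is_prime_ideal (cover_prime C).
Proof.
split; first exact: cover_prime_ideal.
  move=> /(_ 0%MM); rewrite mcoeff_msupp mcoeff1 eqxx oner_eq0 => /(_ isT).
  by case/exists_inP=> x _; rewrite mnm0E.
move=> a b Cab; case: (classic (cover_prime C a)) => [|nCa]; first by left.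
case: (classic (cover_prime C b)) => [|nCb]; first by right.
have [ma [mb [_ _ mab ma_min mb_min]]] := msupp_lowestM (@cover_degD C)
  (not_cover_prime_neq0 nCa) (not_cover_prime_neq0 nCb).
have [a0 a0_a a0C] := not_cover_prime nCa.
have [b0 b0_b b0C] := not_cover_prime nCb.
have /exists_inP[x xC] := Cab _ mab.
have := leq_add (ma_min _ a0_a) (mb_min _ b0_b).
rewrite /= [X in (_ <= X + _)%N]big1 // [X in (_ <= _ + X)%N]big1 //.
rewrite leqn0 -big_split /=.
rewrite sum_nat_eq0 => /forall_inP /(_ x xC) /eqP.
by rewrite mnmDE => ->.
Qed.

(** The witness [h] has exponent [w z - 1] on [C] and [w z] elsewhere. By minimality each [x] in [C]
    has a neighbour outside [C], so [h] times the variable [x] is in the ideal. Conversely [h] has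
    capacity 0 on the cover, so a multiple in the ideal must gain a variable of [C]. *)
Lemma minimal_cover_associated C :
  minset (@vertex_cover p) C -> associated_prime I (cover_prime C).
Proof.
case/minsetP=> covC minC; split; first exact: cover_prime_prime.
have IE f : I f <-> mono_ideal (in_pow w 1) f.
  split; last first.
    move: f; apply: mono_ideal_sub; first exact: ideal_gen_ideal.
    move=> m [z [m' [-> _]]]; rewrite addmC mpolyXD.
    by have [_ _ IM] := ideal_gen_ideal (fun f => exists x y,
         Defs.arc D x y /\ f = 'X_x * 'X_y ^+ w y); apply/IM/edge_ideal_edge.
  move: f; apply: ideal_gen_sub; first exact: in_pow_ideal.
  move=> _ /edge_generatorP [z ->]; apply: mono_idealX.
  by exists z, 0%MM; rewrite addm0.
pose h : 'X_{1..p.+1} :=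
  [multinom if z \in C then (w z).-1 else w z | z < p.+1].
exists 'X_[h] => g; rewrite IE; split=> [Cg m|Ig m mg].
  case/msuppMX_ex=> m' /Cg /exists_inP[x xC m'x] ->.
  have /forallPn[z] : ~~ vertex_cover (C :\ x).
    apply/negP => /minC /(_ (subsetDl _ _)) CxE.
    by have := xC; rewrite -CxE !inE eqxx.
  have fit (k k' : 'I_p.+1) : k \in C -> k' \notin C -> k = x ->
      forall q, (w q * ((k == q) + (k' == q)) <= (m' + h)%MM q)%N.
    move=> kC k'C kx q; rewrite mnmDE mnmE.
    case: (eqVneq k q) => [kq|_]; case: (eqVneq k' q) => [k'q|_].
    - by rewrite k'q -kq kC in k'C.
    - by rewrite muln1 -kq kC kx; have := weight_gt0 D x; lia.
    - by rewrite muln1 -k'q (negPf k'C) leq_addl.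
    - by rewrite muln0.
  move=> nCz; suff: (edge_mon w z <= m' + h)%MM.
    by apply: in_pow_le; apply: (in_pow_muln w z 1).
  apply/mnm_lepP => q; rewrite mnmE.
  have Sz := ordS_neq z p_gt0; have := forallP covC z.
  move: nCz; rewrite !inE; have [zx|zx] := eqVneq z x.
    rewrite -zx Sz /= => SC _; by apply: (fit _ _ _ SC zx); rewrite zx.
  rewrite /=; case zC: (z \in C) => //=; rewrite andbC.
  case SC: (ordS z \in C) => //=; rewrite negbK => /eqP Sx _.
  by rewrite addnC; apply: (fit _ _ SC _ Sx); rewrite zC.
have := in_pow_cover (weight_gt0 D) covC (Ig (m + h)%MM _).
rewrite mem_msuppMX => /(_ mg) lt0.
have /existsP[z /andP[zC]] : [exists z in C, (0 < cap w (m + h)%MM z)%N].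
  apply: contraLR lt0; rewrite negb_exists_in => /forall_inP C0.
  rewrite -leqNgt leqn0 sum_nat_eq0; apply/forall_inP => z zC.
  by have := C0 z zC; rewrite lt0n negbK.
rewrite divn_gt0 ?weight_gt0 // mnmDE mnmE zC => lt_w.
by apply/exists_inP; exists z => //; have := weight_gt0 D z; lia.
Qed.

(** For a minimal cover [C'], some [g] outside its prime multiplies [f] into the power. The lowest
    terms of [g] avoid [C'] and leave the capacities there unchanged, so if [low], the deficient
    part of [f], were nonzero, [g * low] would have a deficient monomial. *)
Lemma symbolic_power_cover s f C m :
  symbolic_power I s f -> vertex_cover C -> m \in msupp f ->
  (s <= \sum_(x in C) cap w m x)%N.
Proof.
move=> If covC; have [C' minC' subC] := minset_exists covC.
suff le_s : mono_ideal (fun m => s <= \sum_(x in C') cap w m x)%N f.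
  move/le_s/leq_trans; apply; rewrite [leqRHS](big_setID C') /=.
  by rewrite (setIidPr subC) leq_addr.
have covC' : vertex_cover C' by case/minsetP: minC'.
have [g nCg] := If _ (minimal_cover_associated minC').
rewrite ideal_powP => Igf; pose low := mpart
  (fun m : 'X_{1..p.+1} => \sum_(x in C') cap w m x < s)%N f.
have le_fg : mono_ideal (fun m => s <= \sum_(x in C') cap w m x)%N (g * low).
  have [m' d le_s|M0 MD MM] := @mono_ideal_ideal K p.+1
      (fun m => s <= \sum_(x in C') cap w m x)%N.
    apply: leq_trans le_s _; apply: leq_sum => x _.
    exact/leq_div2r/mnm_lepP/lem_addr.
  have -> : g * low = g * f + (- g) * (f - low) by rewrite mulNr -mulrBr; ring.
  apply: MD => [m' /Igf|]; first exact/in_pow_cover/covC'/weight_gt0.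
  apply: MM => m'; rewrite mcoeff_msupp mcoeffB mcoeff_mpart.
  by case: ltnP => // _; rewrite subrr eqxx.
move=> m' m'f; rewrite leqNgt; apply/negP => lt_s.
have nz_low : low != 0.
  apply: contraTneq m'f => low0; rewrite mcoeff_msupp negbK.
  by have := mcoeff0 K m'; rewrite -low0 mcoeff_mpart lt_s => ->.
have [mg [mf [_ mf_low mgf mg_min _]]] := msupp_lowestM (@cover_degD C')
  (not_cover_prime_neq0 nCg) nz_low.
have [g0 g0_g g0C] := not_cover_prime nCg.
have := mg_min _ g0_g; rewrite /= [leqRHS]big1 // leqn0 sum_nat_eq0.
move/forall_inP => mgC; have := le_fg _ mgf.
have -> : (\sum_(x in C') cap w (mg + mf)%MM x = \sum_(x in C') cap w mf x)%N.
  by apply: eq_bigr => x /mgC /eqP mgx; rewrite /cap mnmDE mgx.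
move: mf_low; rewrite mcoeff_msupp mcoeff_mpart.
by case: ltnP => [lt_mf _|]; rewrite ?eqxx // leqNgt lt_mf.
Qed.

(** The cover bounds already hold, so only the total capacity can be too small; the exponent
    [s.*2 * w x] at [x] alone provides [s.*2]. *)
Lemma symbolic_power_saturated s f x :
  symbolic_power I s f -> exists k, ideal_pow I s ('X_x ^+ k * f).
Proof.
move=> If; exists (s.*2 * w x)%N; rewrite ideal_powP mulrC mpolyXn => m.
case/msuppMX_ex=> m' m'f ->.
have cap_le z : (cap w m' z <= cap w (m' + U_(x) *+ (s.*2 * w x)) z)%N.
  exact/leq_div2r/mnm_lepP/lem_addr.
apply: cover_in_pow => [|C covC|] //.
  by apply: leq_trans (symbolic_power_cover If covC m'f) _; apply: leq_sum.
rewrite (bigD1 x) //= (leq_trans _ (leq_addr _ _)) //.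
by rewrite /cap mnmDE mulmnE mnm1E eqxx mul1n divnDMl ?weight_gt0 // leq_addl.
Qed.

End EdgeIdeal.

(** * Local cohomology of monomial ideals *)

Section AlternatingSums.
Variables (A : comNzRingType) (N : nat).
Implicit Types (T S : {set 'I_N}) (x y : 'I_N) (c : {set 'I_N} -> A).

(** The Cech signs over any ring, to serve for fractions, polynomials and coefficients alike. *)
Definition asign x T : A := (-1) ^+ #|[set y in T | (y < x)%N]|.

Definition adiff c T : A := \sum_(x in T) asign x T * c (T :\ x).

Lemma asign_sqr x T : asign x T * asign x T = 1.
Proof. by rewrite /asign -expr2 sqrr_sign. Qed.

(** Deleting the smaller element flips the sign of the larger one; deleting the larger one changes
    nothing. *)
Lemma asignC x y T : x \in T -> y \in T -> x != y ->
  asign x T * asign y (T :\ x) = - (asign y T * asign x (T :\ y)).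
Proof.
move=> xT yT ne_xy; wlog lt_xy : x y xT yT ne_xy / (x < y)%N => [Hw|].
  have [|lt_yx|/val_inj eq_xy] := ltngtP x y; first exact: Hw.
    by rewrite [in RHS]Hw ?opprK // eq_sym.
  by rewrite eq_xy eqxx in ne_xy.
have -> : asign x (T :\ y) = asign x T.
  congr (_ ^+ #|pred_of_set _|); apply/setP => z; rewrite !inE.
  by have [->|_] := eqVneq z y; rewrite //= ltnNge (ltnW lt_xy) andbF.
rewrite mulrC -mulNr; congr (_ * _); rewrite /asign.
rewrite [in RHS](cardsD1 x) inE xT lt_xy exprS mulN1r opprK.
congr (_ ^+ #|pred_of_set _|); apply/setP => z; rewrite !inE andbA.
by [].
Qed.

Lemma adiff_adiff c T : adiff (adiff c) T = 0.
Proof.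
pose F x y := asign x T * (asign y (T :\ x) * c (T :\ x :\ y)).
have FC x y : x \in T -> y \in T -> x != y -> F x y = - F y x.
  move=> xT yT ne_xy; rewrite /F !mulrA asignC // mulNr.
  by rewrite setDDl setUC -setDDl.
rewrite /adiff (eq_bigr (fun x => \sum_(y in T | (y < x)%N) F x y +
                                  \sum_(y in T | (x < y)%N) F x y)).
  rewrite big_split /=.
  have -> : \sum_(x in T) \sum_(y in T | (x < y)%N) F x y =
            \sum_(x in T) \sum_(y in T | (y < x)%N) F y x.
    rewrite (exchange_big_dep (mem T)) => [|x y _ /andP[]] //=.
    by apply: eq_bigr => y yT; apply: eq_bigl => x; rewrite yT.
  rewrite -big_split big1 //= => x xT; rewrite -big_split big1 //=.
  by move=> y /andP[yT lt_yx]; rewrite FC ?addNr // neq_ltn lt_yx orbT.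
move=> x xT; rewrite mulr_sumr.
rewrite (bigID (fun y : 'I_N => (y < x)%N)) /=; congr (_ + _).
  apply: eq_bigl => y; rewrite !inE.
  by have [->|_] := eqVneq y x; rewrite ?ltnn ?andbF.
apply: eq_bigl => y; rewrite !inE -leqNgt.
have -> : (x < y)%N = (y != x) && (x <= y)%N by rewrite ltn_neqAle eq_sym.
by rewrite andbCA andbA.
Qed.

Definition cone x c S : A :=
  if x \in S then 0 else asign x (x |: S) * c (x |: S).

(** The contraction at [x] gives an explicit primitive of a cocycle; whether its values are
    admissible cochains is a separate matter. *)
Lemma adiff_cone x c T :
  (x \notin T -> adiff c (x |: T) = 0) -> adiff (cone x c) T = c T.
Proof.
have [xT _|xT /(_ isT)] := boolP (x \in T).
  rewrite /adiff (bigD1 x) //= big1 => [|y /andP[yT ne_yx]].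
    by rewrite /cone !inE eqxx /= setD1K // mulrA asign_sqr mul1r addr0.
  by rewrite /cone !inE eq_sym ne_yx xT mulr0.
rewrite {1}/adiff (bigD1 x) ?setU11 //= setU1K // => /eqP.
rewrite addr_eq0 => /eqP eq_c.
transitivity (asign x (x |: T) * (asign x (x |: T) * c T)); last first.
  by rewrite mulrA asign_sqr mul1r.
rewrite eq_c mulrN mulr_sumr -sumrN /adiff.
apply: eq_big => [y|y yT].
  by rewrite !inE; have [->|] := eqVneq y x; rewrite ?andbT //= (negPf xT).
have ne_xy : x != y by apply: contraNneq xT => ->.
have -> : (x |: T) :\ y = x |: (T :\ y).
  by apply/setP => z; rewrite !inE; have [->|] := eqVneq z x; rewrite ?ne_xy.
rewrite /cone !inE (negPf xT) andbF !mulrA -mulNr; congr (_ * _).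
have yU : y \in x |: T by rewrite !inE yT orbT.
have := asignC (setU11 x T) yU ne_xy; rewrite setU1K //.
have -> : (x |: T) :\ y = x |: (T :\ y).
  by apply/setP => z; rewrite !inE; have [->|] := eqVneq z x; rewrite ?ne_xy.
move=> eq_s; rewrite -[LHS]mul1r -(asign_sqr x (x |: T)).
rewrite mulrA -[_ * _ * asign y T]mulrA eq_s mulrN mulNr; congr (- _).
by rewrite -!mulrA asign_sqr mulr1.
Qed.

End AlternatingSums.

Local Notation full k := (mesym1 [set: 'I__] *+ k)%MM.

(** * Cochains as Laurent polynomials *)

Section Laurent.
Variables (K : fieldType) (N : nat).
Notation R := {mpoly K[N]}.
Implicit Types (S T : {set 'I_N}) (f g h : R) (m d : 'X_{1..N}) (I : R -> Prop).

(** One denominator for all sets [S] turns a cochain into a family of polynomials, comparable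
    coefficient by coefficient. *)
Definition laurent k g : {fraction R} :=
  tofrac g / tofrac (varprod K [set: 'I_N] ^+ k).

Lemma varprodX S : varprod K S = 'X_[mesym1 S].
Proof.
rewrite mpolyXE_id /varprod [LHS]big_mkcond; apply: eq_bigr => x _.
by rewrite mnmE; case: (x \in S); rewrite ?expr1.
Qed.

Lemma varprodXn S k : varprod K S ^+ k = 'X_[mesym1 S *+ k].
Proof. by rewrite varprodX mpolyXn. Qed.

Lemma mpolyX_neq0 m : 'X_[m] != 0 :> R.
Proof. by rewrite -msupp_eq0 msuppX. Qed.

Lemma varprod_neq0 S k : tofrac (varprod K S ^+ k) != 0.
Proof. by rewrite tofrac_eq0 varprodXn mpolyX_neq0. Qed.

Lemma frac_varprod_eq f g S T k l :
  tofrac f / tofrac (varprod K S ^+ k) =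
    tofrac g / tofrac (varprod K T ^+ l) <->
  f * 'X_[mesym1 T *+ l] = g * 'X_[mesym1 S *+ k].
Proof.
rewrite -!varprodXn; split=> [/eqP|eq_fg]; last apply/eqP.
  by rewrite eqr_div ?varprod_neq0 // -!tofracM tofrac_eq => /eqP.
by rewrite eqr_div ?varprod_neq0 // -!tofracM eq_fg.
Qed.

Lemma laurent_inj k : injective (laurent k).
Proof. by move=> f g /frac_varprod_eq /mulIf; apply; apply: mpolyX_neq0. Qed.

Lemma laurent0 k : laurent k 0 = 0.
Proof. by rewrite /laurent tofrac0 mul0r. Qed.

Lemma laurentM k l g : laurent k g = laurent (k + l) (g * 'X_[full l]).
Proof.
apply/frac_varprod_eq; rewrite -mulrA -mpolyXD; congr (_ * 'X_[_]).
by apply/mnmP => x; rewrite mnmDE !mulmnE -mulnDr addnC.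
Qed.

Lemma adiff_laurent k (g : {set 'I_N} -> R) T :
  adiff (fun S => laurent k (g S)) T = laurent k (adiff g T).
Proof.
rewrite /laurent /adiff rmorph_sum mulr_suml; apply: eq_bigr => x _ /=.
by rewrite rmorphM /asign rmorph_sign mulrA.
Qed.

Lemma eq_adiff (A : comNzRingType) (c c' : {set 'I_N} -> A) i T :
  #|T| = i.+1 -> (forall S, #|S| = i -> c S = c' S) -> adiff c T = adiff c' T.
Proof.
move=> cardT eq_c; apply: eq_bigr => x xT; rewrite eq_c //.
by apply/eqP; rewrite -eqSS -cardT (cardsD1 x T) xT.
Qed.

Lemma mcoeff_adiff (g : {set 'I_N} -> R) T m :
  (adiff g T)@_m = adiff (fun S => (g S)@_m) T.
Proof.
by rewrite /adiff raddf_sum; apply: eq_bigr => x _; rewrite raddfMsign.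
Qed.

Lemma loc_piece_laurent I S j u :
  loc_piece I S j u -> exists k0, forall k, (k0 <= k)%N ->
  exists g, u = laurent k g.
Proof.
case=> k0 [f [_ _ ->]]; exists k0 => k le_k.
exists (f * 'X_[full k - mesym1 S *+ k0]); apply/frac_varprod_eq.
rewrite -mulrA -mpolyXD submK //; apply/mnm_lepP => x; rewrite !mulmnE.
by apply: leq_mul; rewrite // !mnmE inE; case: (x \in S).
Qed.

Lemma cochain_laurent I i j c k0 :
  cech_cochain I i j c ->
  exists k (g : {set 'I_N} -> R),
    (k0 <= k)%N /\ forall S, #|S| = i -> c S = laurent k (g S).
Proof.
move=> c_in; have /fin_all_exists[ks ksP] S : exists k1, #|S| = i ->
    forall k, (k1 <= k)%N -> exists g, c S = laurent k g.
  case: (eqVneq #|S| i) => [Si|ne].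
    by have [k1 k1P] := loc_piece_laurent (c_in S Si); exists k1.
  by exists 0%N => Si; rewrite Si eqxx in ne.
pose k := maxn k0 (\max_S ks S).
have /fin_all_exists[g gP] S : exists g, #|S| = i -> c S = laurent k g.
  case: (eqVneq #|S| i) => [Si|ne]; last first.
    by exists 0 => Si; rewrite Si eqxx in ne.
  have [|g ->] := ksP S Si k; last by exists g.
  by rewrite (leq_trans _ (leq_maxr _ _)) // (leq_bigmax S).
by exists k, g; split; first exact: leq_maxl.
Qed.

Lemma mpolyX_divides d g :
  (forall m, m \in msupp g -> (d <= m)%MM) -> exists h, g = h * 'X_[d].
Proof.
move=> le_d; exists (\sum_(m <- msupp g) g@_m *: 'X_[m - d]).
rewrite mulr_suml [LHS]mpolyE big_seq [RHS]big_seq; apply: eq_bigr => m mg.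
by rewrite -scalerAl -mpolyXD submK // le_d.
Qed.

End Laurent.

(** * The multigraded Cech complex of a monomial ideal *)

Section MonomialCech.
Variables (K : fieldType) (N : nat) (A : 'X_{1..N} -> Prop).
Hypothesis upA : forall m d, A m -> A (m + d)%MM.
Notation R := {mpoly K[N]}.
Notation J := (@mono_ideal K N A).
Implicit Types (S T : {set 'I_N}) (f g h : R) (m d : 'X_{1..N}).

(* [x^m / (x_1 ... x_N)^k] belongs to the localization of the monomial ideal
   at the variables in [S]. *)
Definition loc_mono S k m := exists l m',
  A m' /\ (m + mesym1 S *+ l)%MM = (m' + full k)%MM.

Lemma loc_mono_uniform S k g :
  (forall m, m \in msupp g -> loc_mono S k m) -> exists l, forall m,
  m \in msupp g -> exists m', A m' /\ (m + mesym1 S *+ l)%MM = (m' + full k)%MM.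
Proof.
elim: (msupp g) => [|m0 s IHs] g_in; first by exists 0%N.
have [|l lP] := IHs; first by move=> m ms; apply: g_in; rewrite inE ms orbT.
have [l0 [m' [Am' m'E]]] := g_in m0 (mem_head _ _).
have shift l1 l2 m : (m + mesym1 S *+ (l1 + l2) =
    m + mesym1 S *+ l1 + mesym1 S *+ l2)%MM.
  by apply/mnmP => x; rewrite !mnmDE !mulmnE mulnDr addnA.
exists (l0 + l)%N => m /[1!inE] /orP[/eqP->|/lP[m1 [Am1 m1E]]].
  exists (m' + mesym1 S *+ l)%MM; split; first exact: upA.
  by rewrite shift m'E -!addmA; congr mnm_add; rewrite addmC.
exists (m1 + mesym1 S *+ l0)%MM; split; first exact: upA.
by rewrite addnC shift m1E -!addmA; congr mnm_add; rewrite addmC.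
Qed.

(** Membership is decided one monomial at a time, since finitely many monomials share an exponent
    [l]; [k * N] is the degree of the denominator. *)
Lemma loc_piece_monoP S j k g :
  loc_piece J S j (laurent k g) <->
  forall m, m \in msupp g ->
    (mdeg m)%:Z = j + (k * N)%:Z /\ loc_mono S k m.
Proof.
split=> [[l [f [Jf f_j /frac_varprod_eq eq_gf]]] m mg|g_in].
  have : (m + mesym1 S *+ l)%MM \in msupp (f * 'X_[full k]).
    by rewrite -eq_gf mem_msuppMX.
  case/msuppMX_ex=> m' m'f m'E; split; last first.
    by exists l, m'; split=> //; apply: Jf.
  have := congr1 (@mdeg N) m'E; have := f_j _ m'f.
  by rewrite !mdegD !mdegMn !mdeg_mesym1 cardsT card_ord; lia.
have [m /g_in[] //|l lP] := @loc_mono_uniform S k g.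
have [|f fE] := @mpolyX_divides K N (full k) (g * 'X_[mesym1 S *+ l]).
  by move=> _ /msuppMX_ex[m /lP[m' [_ m'E]] ->]; rewrite m'E lem_addl.
have f_in m : m \in msupp f -> A m /\ (mdeg m)%:Z = j + (l * #|S|)%:Z.
  rewrite -(mem_msuppMX m (full k)) -fE => /msuppMX_ex[m1 m1g m1E].
  have [m' [Am' m'E]] := lP m1 m1g; rewrite -m1E in m'E.
  split; first by rewrite (addIm m'E).
  have [+ _] := g_in _ m1g; have := congr1 (@mdeg N) m1E.
  by rewrite !mdegD !mdegMn !mdeg_mesym1 cardsT card_ord; lia.
exists l, f; split=> [m /f_in[] //|m /f_in[] //|].
by apply/frac_varprod_eq; rewrite fE.
Qed.

(* If the exponent of [x] is at least [rho], inverting [x] does not change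
   membership, so the corresponding multigraded part of the complex is a
   cone. *)
Lemma lc_mono_bounded rho i j :
    (forall m m', A m -> (forall z, minn (m z) rho <= m' z)%N -> A m') ->
    (0 < N)%N ->
  lc_neq0 J i j -> j < (N * rho)%:Z.
Proof.
move=> truncA N_gt0 [c [c_in c_cyc c_ncob]]; rewrite ltNge; apply/negP => le_j.
have [k [g [_ cE]]] := cochain_laurent 0 c_in.
have g_in S m : #|S| = i -> m \in msupp (g S) ->
    (mdeg m)%:Z = j + (k * N)%:Z /\ loc_mono S k m.
  by move=> Si; move: m; apply/loc_piece_monoP; rewrite -cE //; apply: c_in.
have g_cyc T : #|T| = i.+1 -> adiff g T = 0.
  move=> Ti; apply: (@laurent_inj K N k); rewrite laurent0 -adiff_laurent.
  by rewrite -(c_cyc T Ti); apply: eq_adiff Ti _ => S /cE.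
(* A monomial of degree at least [N * (k + rho)] has an exponent that reaches [k + rho], so the
   default does not occur for the monomials of [g]. *)
pose big m := odflt (Ordinal N_gt0) [pick x | k + rho <= m x]%N.
have bigP m : (mdeg m)%:Z = j + (k * N)%:Z -> (k + rho <= m (big m))%N.
  rewrite /big => m_j; case: pickP => // small.
  have : (mdeg m <= \sum_(x < N) (k + rho).-1)%N.
    by rewrite mdegE; apply: leq_sum => x _; have := small x; lia.
  have : (\sum_(x < N) (k + rho).-1 < N * (k + rho))%N.
    have /negP := small (Ordinal N_gt0).
    by rewrite sum_nat_const card_ord; nia.
  by lia.
pose b S := \sum_x mpart (fun m => big m == x) (cone x g S).
have bE S m : (b S)@_m = cone (big m) (fun S' => (g S')@_m) S.
  rewrite raddf_sum (bigD1 (big m)) //= mcoeff_mpart eqxx.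
  rewrite big1 => [|x /negPf ne].
    by rewrite addr0 /cone; case: ifP; rewrite ?mcoeff0 // raddfMsign.
  by rewrite mcoeff_mpart eq_sym ne.
apply: c_ncob; exists (fun S => laurent k (b S)); split=> [S Si|T Ti].
  apply/loc_piece_monoP => m; rewrite mcoeff_msupp bE /cone.
  case: ifP => [|/negbT nS]; first by rewrite eqxx.
  rewrite mulf_eq0 signr_eq0 /= -mcoeff_msupp.
  case/g_in=> [|m_j [l [m' [Am' m'E]]]]; first by rewrite cardsU1 nS.
  (* Here [big m] is no longer inverted. The new exponents differ from [m'] at most there, where at
     least [rho] is left after division. *)
  split=> //; exists l, (m + mesym1 S *+ l - full k)%MM.
  have mz z : ((m + mesym1 S *+ l)%MM z =
      if z == big m then m z else m' z + k)%N.
    have := congr1 (fun m => m z) m'E; rewrite /= !mnmDE !mulmnE !mnmE !inE.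
    by case: eqVneq => [->|_]; rewrite ?(negPf nS) //= ?mul0n ?addn0 ?mul1n.
  have big_m := bigP m m_j.
  split; last first.
    rewrite submK //; apply/mnm_lepP => z; rewrite mz mulmnE mnmE inE mul1n.
    by case: eqVneq => [->|_]; lia.
  apply: truncA Am' _ => z; rewrite mnmBE mz mulmnE mnmE inE mul1n.
  by case: eqVneq => [->|_]; lia.
rewrite cE // [RHS]adiff_laurent; congr laurent; apply/mpolyP => m.
rewrite mcoeff_adiff -[LHS](@adiff_cone _ _ (big m) (fun S => (g S)@_m)).
  by apply: eq_bigr => x _; rewrite bE.
by move=> nT; rewrite -mcoeff_adiff g_cyc ?mcoeff0 // cardsU1 nT Ti.
Qed.

(** A 1-cocycle is a single fraction lying in the localizations at all variables. It is a polynomial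
    in the saturation, and it is a coboundary as soon as it lies in the ideal. *)
Lemma lc_mono_one j : (1 < N)%N -> lc_neq0 J 1 j ->
  exists m, [/\ ~ A m, (mdeg m)%:Z = j
    & forall x, exists l, A (m + U_(x) *+ l)%MM].
Proof.
move=> N_gt1 [c [c_in c_cyc c_ncob]].
have [k [g [_ cE]]] := cochain_laurent 0 c_in.
pose x0 := Ordinal (ltnW N_gt1); pose x1 := Ordinal N_gt1.
have g_in x m : m \in msupp (g [set x]) ->
    (mdeg m)%:Z = j + (k * N)%:Z /\ loc_mono [set x] k m.
  by move: m; apply/loc_piece_monoP; rewrite -cE ?cards1 //; apply/c_in/cards1.
have gE x : g [set x] = g [set x0].
  have [->//|ne_x] := eqVneq x x0.
  have T2 : #|[set x; x0]| = 2 by rewrite cards2 ne_x.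
  have := c_cyc _ T2.
  rewrite [LHS](_ : _ = adiff (fun S => laurent k (g S)) [set x; x0]).
    rewrite adiff_laurent -(laurent0 K N k) => /laurent_inj.
    have D1 : [set x; x0] :\ x = [set x0].
      by rewrite setU1K // inE.
    have D2 : [set x; x0] :\ x0 = [set x].
      by rewrite setUC setU1K // inE eq_sym.
    have sign1 y : asign {mpoly K[N]} y [set y] = 1.
      rewrite /asign (_ : [set _ in _ | _] = set0) ?cards0 //.
      by apply/setP => z; rewrite !inE; case: eqP => // ->; rewrite ltnn.
    have := @asignC {mpoly K[N]} N x x0 [set x; x0].
    rewrite !inE !eqxx orbT D1 D2 !sign1 !mulr1 => /(_ isT isT ne_x) sE.
    rewrite /adiff big_setU1 ?inE //= big_set1 D1 D2 sE mulNr => /eqP.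
    rewrite addrC subr_eq0 => /eqP /(congr1 ( *%R (asign _ x0 [set x; x0]))).
    by rewrite !mulrA asign_sqr !mul1r.
  by apply: (eq_adiff T2) => S /cE.
(* Each [z] differs from some variable [x], and inverting [x] allows no [z] in the denominator. *)
have [m mg|h hE] := @mpolyX_divides K N (full k) (g [set x0]).
  apply/mnm_lepP => z; rewrite mulmnE mnmE inE mul1n.
  have [x ne_zx] : exists x, z != x.
    by have [->|] := eqVneq z x0; [exists x1 | exists x0].
  rewrite -(gE x) in mg; have [_ [l [m' [_ m'E]]]] := g_in _ _ mg.
  have := congr1 (fun m => m z) m'E; rewrite /= !mnmDE !mulmnE !mnmE !inE.
  by rewrite (negPf ne_zx); lia.
have cE' x : c [set x] = tofrac h.
  rewrite cE ?cards1 // gE hE -[k]add0n -laurentM /laurent expr0.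
  by rewrite tofrac1 divr1.
have nJh : ~ J h.
  move=> Jh; apply: c_ncob; exists (fun=> tofrac h); split=> [S [S0]|T T1].
    exists 0%N, h; split=> //; last by rewrite expr0 tofrac1 divr1.
    move=> m mh; rewrite mul0n addr0.
    have := g_in x0 (m + full k)%MM; rewrite hE mem_msuppMX => /(_ mh)[+ _].
    by rewrite mdegD mdegMn mdeg_mesym1 cardsT card_ord; lia.
  have /cards1P[x ->] : #|T| == 1 by rewrite T1.
  rewrite cE' /cech_diff big_set1 (_ : [set _ in _ | _] = set0).
    by rewrite cards0 mul1r.
  by apply/setP => z; rewrite !inE; case: eqP => // ->; rewrite ltnn.
have [m mh nAm] : exists2 m, m \in msupp h & ~ A m.
  apply: NNPP => nex; apply: nJh => m mh; apply: NNPP => nAm; apply: nex.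
  by exists m.
exists m; split=> // [|x].
  have := g_in x0 (m + full k)%MM; rewrite hE mem_msuppMX => /(_ mh)[+ _].
  by rewrite mdegD mdegMn mdeg_mesym1 cardsT card_ord; lia.
have [] := g_in x (m + full k)%MM; first by rewrite gE hE mem_msuppMX.
move=> _ [l [m' [Am' m'E]]]; exists l; rewrite -mesym1_set1.
suff -> : (m + mesym1 [set x] *+ l)%MM = m' by [].
apply: (@addIm _ (full k)); rewrite -m'E -!addmA; congr mnm_add.
by rewrite addmC.
Qed.

(** The class is the differential of one Laurent monomial placed at [T :\ u], hence a cocycle, and
    the first condition puts its values in the localized ideal. At [T] the coefficient of this
    monomial is a sign, but by the second condition it is 0 for every coboundary of the ideal. *)
Lemma lc_mono_neq0 T u k m :
    u \in T ->
    (forall y, y \notin T :\ u -> loc_mono (y |: T :\ u) k m) ->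
    (forall x, x \in T -> ~ loc_mono (T :\ x) k m) ->
  lc_neq0 J #|T| ((mdeg m)%:Z - (k * N)%:Z).
Proof.
move=> uT in_m out_m; pose g S : R := if S == T :\ u then 'X_[m] else 0.
have gE S m' : (g S)@_m' = ((S == T :\ u) && (m == m'))%:R.
  by rewrite /g; case: ifP; rewrite ?mcoeffX ?mcoeff0.
exists (fun S => laurent k (adiff g S)); split=> [S ST|S ST|].
- apply/loc_piece_monoP => m'; rewrite mcoeff_msupp mcoeff_adiff => nz.
  have [x xS] : exists2 x, x \in S & (g (S :\ x))@_m' != 0.
    apply/exists_inP; apply: contraNT nz; rewrite negb_exists_in.
    move=> /forall_inP g0; rewrite /adiff big1 // => x xS.
    by have := g0 x xS; rewrite negbK => /eqP->; rewrite mulr0.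
  rewrite gE; case: andP => [[/eqP SE /eqP <-] _|]; last by rewrite eqxx.
  split; first by rewrite subrK.
  by rewrite -(setD1K xS) SE; apply: in_m; rewrite -SE !inE eqxx.
- rewrite -[LHS]/(adiff (fun S => laurent k (adiff g S)) S).
  by rewrite adiff_laurent adiff_adiff laurent0.
case=> b [b_in bE].
have b_coch : cech_cochain J #|T|.-1 ((mdeg m)%:Z - (k * N)%:Z) b.
  move=> S ST; apply: b_in; rewrite ST prednK // card_gt0.
  by apply: contraTneq uT => ->; rewrite inE.
have [k' [g' [le_k b'E]]] := cochain_laurent k b_coch.
have cardT x : x \in T -> #|T :\ x| = #|T|.-1.
  by move=> xT; rewrite (cardsD1 x T) xT.
have := bE T erefl; rewrite -[cech_diff b T]/(adiff b T).
have -> : adiff b T = adiff (fun S => laurent k' (g' S)) T.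
  by apply: eq_bigr => x xT; rewrite b'E ?cardT.
rewrite adiff_laurent (laurentM k (k' - k)) subnKC // => /laurent_inj.
move/(congr1 (mcoeff (m + full (k' - k))%MM)); rewrite addmC mcoeffMX.
rewrite !mcoeff_adiff {1}/adiff (bigD1 u) //= gE !eqxx mulr1.
rewrite big1 => [|x /andP[xT ne_xu]]; last first.
  rewrite gE (_ : (_ == _) = false) ?mulr0 //.
  by apply/negP => /eqP /setP /(_ x); rewrite !inE eqxx xT ne_xu.
rewrite /adiff big1 => [/eqP|x xT]; first by rewrite addr0 signr_eq0.
rewrite memN_msupp_eq0 ?mulr0 //; apply/negP => m_g'.
have := b_coch (T :\ x) (cardT x xT); rewrite b'E ?cardT //.
move/loc_piece_monoP => /(_ _ m_g') [_ [l [m' [Am' m'E]]]].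
apply: (out_m x xT); exists l, m'; split=> //.
apply/mnmP => z; have := congr1 (fun m => m z) m'E; move: le_k.
by rewrite /= !mnmDE !mulmnE !mnmE !inE; lia.
Qed.

End MonomialCech.

Lemma bounded_int_max (P : int -> Prop) (a b : int) :
  P a -> (forall x, P x -> x <= b) -> exists c, is_max P c.
Proof.
move=> Pa leb; have [d] : exists d : nat, b - a <= d%:Z.
  by exists `|b - a|%N; rewrite abszE ler_norm.
elim: d a Pa => [|d IHd] a Pa le_d.
  by exists a; split=> // x /leb; lia.
case: (classic (exists2 x, P x & a < x)) => [[x Px lt_ax]|nex].
  by apply: (IHd x Px); lia.
exists a; split=> // x Px; rewrite leNgt; apply/negP => lt_ax.
by apply: nex; exists x.
Qed.

(** * Ideals with the same saturation *)

Section Saturation.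
Variables (K : fieldType) (N : nat).
Notation R := {mpoly K[N]}.
Implicit Types (J : R -> Prop) (S : {set 'I_N}).

Lemma lc_zero J j : (0 < N)%N -> ~ lc_neq0 J 0 j.
Proof.
move=> N_gt0 [c [_ c_cyc]]; apply; exists (fun=> 0); split=> // T /cards0_eq->.
have := c_cyc [set Ordinal N_gt0]; rewrite cards1 => /(_ erefl).
rewrite /cech_diff big_set1 big_set0 setDv => /eqP.
by rewrite mulf_eq0 signr_eq0 => /eqP.
Qed.

Lemma loc_piece_sub (J J' : R -> Prop) S j u :
  (forall f, J f -> J' f) -> loc_piece J S j u -> loc_piece J' S j u.
Proof. by move=> subJ [k [f [/subJ Jf f_j uE]]]; exists k, f. Qed.

(** A power of [varprod S], a unit in the localization, moves the numerator into [J]. *)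
Lemma loc_piece_saturated (J J' : R -> Prop) S j u :
    is_ideal J -> (forall f x, J' f -> exists k, J ('X_x ^+ k * f)) ->
    S != set0 ->
  loc_piece J' S j u -> loc_piece J S j u.
Proof.
case=> _ _ JM satJ /set0Pn[x xS] [k [f [/satJ J'f f_j uE]]].
have [l Jl] := J'f x; exists (k + l)%N, (varprod K S ^+ l * f); split.
- rewrite /varprod (bigD1 x) //= exprMn -mulrA mulrCA.
  exact: JM.
- rewrite varprodXn mulrC => m /msuppMX_ex[m' /f_j m'_j ->].
  by rewrite mdegD mdegMn mdeg_mesym1; lia.
rewrite uE; apply/frac_varprod_eq; rewrite varprodXn mulrAC mulrC.
by congr (_ * _); rewrite -mpolyXD; congr 'X_[_]; apply/mnmP => z;
  rewrite mnmDE !mulmnE -mulnDr addnC.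
Qed.

Variables J J' : R -> Prop.
Hypothesis J_ideal : is_ideal J.
Hypothesis subJ : forall f, J f -> J' f.
Hypothesis satJ : forall f x, J' f -> exists k, J ('X_x ^+ k * f).

Lemma loc_piece_saturatedP S j u :
  (0 < #|S|)%N -> loc_piece J' S j u <-> loc_piece J S j u.
Proof.
rewrite card_gt0 => S0; split; last exact: loc_piece_sub.
exact: loc_piece_saturated.
Qed.

(** Only sets of size [i] and [i - 1] carry a membership condition, and these are nonempty. *)
Lemma lc_neq0_saturated i j : (1 < i)%N -> lc_neq0 J' i j <-> lc_neq0 J i j.
Proof.
move=> i_gt1; split=> -[c [c_in c_cyc c_ncob]]; exists c; split=> //.
- by move=> S Si; apply/loc_piece_saturatedP; [lia | apply: c_in].
- case=> b [b_in bE]; apply: c_ncob; exists b; split=> // S Si.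
  by apply/loc_piece_saturatedP; [lia | apply: b_in].
- by move=> S Si; apply/loc_piece_saturatedP; [lia | apply: c_in].
case=> b [b_in bE]; apply: c_ncob; exists b; split=> // S Si.
by apply/loc_piece_saturatedP; [lia | apply: b_in].
Qed.

(** Coboundaries in degree 1 come from the empty set, where [J'] may have more cochains than [J];
    hence one direction only. *)
Lemma lc_neq0_saturated1 j : lc_neq0 J' 1 j -> lc_neq0 J 1 j.
Proof.
case=> c [c_in c_cyc c_ncob]; exists c; split=> //.
  by move=> S S1; apply/loc_piece_saturatedP; [rewrite S1 | apply: c_in].
case=> b [b_in bE]; apply: c_ncob; exists b; split=> // S Si.
exact/loc_piece_sub/b_in.
Qed.

Lemma is_reg_of_high (I : R -> Prop) r b :
    (0 < N)%N -> (forall i j, lc_neq0 I i j -> j <= b) ->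
    (forall j, lc_neq0 I 1 j -> j + 1 <= r) ->
    is_max (fun t => exists i j,
      [/\ (1 < i <= N)%N, lc_neq0 I i j & t = j + i%:Z]) r ->
  @is_reg K N I r.
Proof.
move=> N_gt0 leb le1 [[i [j [/andP[i_gt1 le_iN] Hij rE]]] max_r]; split.
  by move=> i' _ [j' Hj']; apply: bounded_int_max Hj' _ => x; apply: leb.
split.
  exists i, j; split=> //; split=> // j' Hj'.
  have : j' + i%:Z <= r by apply: max_r; exists i, j'; rewrite i_gt1.
  by rewrite rE lerD2r.
move=> _ [[|[|i']] [a [le_i'N [Ha _] ->]]].
- by case: (lc_zero N_gt0 Ha).
- exact: le1.
by apply: max_r; exists i'.+2, a.
Qed.

(** The class in degree [i0] lifts the maximum over degrees above 1 to at least [d], which bounds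
    the contribution of degree 1 for both ideals; above degree 1 their cohomology agrees. The bound
    [b] makes the maxima exist. *)
Lemma common_reg b d i0 j0 :
    (0 < N)%N -> (forall i j, lc_neq0 J i j -> j <= b) ->
    (forall j, lc_neq0 J 1 j -> j + 1 <= d) ->
    (1 < i0 <= N)%N -> lc_neq0 J i0 j0 -> d <= j0 + i0%:Z ->
  exists r, is_reg J' r /\ is_reg J r.
Proof.
move=> N_gt0 leb led i0_in Hj0 le_d; pose high I t := exists i j,
  [/\ (1 < i <= N)%N, @lc_neq0 K N I i j & t = j + i%:Z].
have [r [r_in r_max]] : exists r, is_max (high J) r.
  apply: (@bounded_int_max _ (j0 + i0%:Z) (b + N%:Z)); first by exists i0, j0.
  by move=> _ [i [j [/andP[_ le_iN] /leb le_jb ->]]]; lia.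
have le_r : d <= r.
  by apply: le_trans le_d _; apply: r_max; exists i0, j0.
have highJ' t : high J' t <-> high J t.
  by split=> -[i [j [i_in Hj tE]]]; exists i, j; split=> //;
    apply/lc_neq0_saturated => //; case/andP: i_in.
exists r; split; last first.
  by apply: (is_reg_of_high N_gt0 leb) => // j /led; lia.
apply: (@is_reg_of_high _ r b N_gt0).
- case=> [|[|i]] j Hj; first by case: (lc_zero N_gt0 Hj).
    exact/leb/lc_neq0_saturated1/Hj.
  by apply: (leb i.+2); apply/lc_neq0_saturated.
- by move=> j /lc_neq0_saturated1/led; lia.
by split=> [|t]; [apply/highJ' | move/highJ'/r_max].
Qed.

End Saturation.

(** * Cycles with one vertex of large weight *)

Section OneHeavyVertex.
Local Open Scope nat_scope.
Variables (p : nat) (w : 'I_p.+1 -> nat) (v : 'I_p.+1).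
Hypothesis p_gt0 : 0 < p.
Hypothesis w_gt0 : forall x, 0 < w x.
Hypothesis w1 : forall x, x != v -> w x = 1.
Implicit Types (m : 'X_{1..p.+1}) (s : nat).

Lemma setC1_cover : vertex_cover (~: [set v]).
Proof.
apply/forallP => x; rewrite !inE -negb_and; apply/andP => -[/eqP-> /eqP vS].
by have := ordS_neq v p_gt0; rewrite vS eqxx.
Qed.

(** A cover missing [x] ignores the exponent of [x], so saturation gives the cover bound for [m]
    itself; the full vertex set contains the cover that misses [v]. The total capacity must then be
    below [s.*2]. *)
Lemma in_pow_saturated_mdeg s m :
    ~ in_pow w s m -> (forall x, exists l, in_pow w s (m + U_(x) *+ l)%MM) ->
  (mdeg m).+1 <= s * (w v).+1.
Proof.
move=> nm satm; have cov_s C : vertex_cover C -> s <= \sum_(z in C) cap w m z.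
  have proper D : vertex_cover D -> D != setT -> s <= \sum_(z in D) cap w m z.
    move=> covD; rewrite -subTset => /subsetPn[x _ nDx].
    have [l /(in_pow_cover w_gt0 covD)/leq_trans] := satm x; apply.
    apply: leq_sum => z zD; rewrite /cap mnmDE mulmnE mnm1E.
    by case: eqP zD nDx => [->->//|_ _ _]; rewrite mul0n addn0.
  have [->|] := eqVneq C setT; last by move=> ? ?; apply: proper.
  move=> _; have := proper _ setC1_cover; rewrite -subTset.
  have -> : [set: 'I_p.+1] \subset ~: [set v] = false.
    by apply/negP => /subsetP /(_ v (in_setT v)); rewrite !inE eqxx.
  move=> /(_ isT)/leq_trans; apply.
  rewrite [leqRHS](bigID (mem (~: [set v]))) /=.
  by under [X in _ <= X + _]eq_bigl do rewrite inE; apply: leq_addr.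
have lt_2s : \sum_z cap w m z < s.*2.
  by rewrite ltnNge; apply/negP => le_2s; apply: nm; apply: cover_in_pow.
have := cov_s _ setC1_cover.
rewrite (eq_bigl (fun z => z != v)) => [le_s|z]; last by rewrite !inE.
have -> : mdeg m = m v + \sum_(z | z != v) cap w m z.
  rewrite mdegE (bigD1 v) //=; congr (_ + _).
  by apply: eq_bigr => z /w1 wz; rewrite /cap wz divn1.
move: lt_2s; rewrite (bigD1 v) //=.
have := ltn_ceil (m v) (w_gt0 v); rewrite -/(cap w m v).
move: le_s (w_gt0 v); set B := \sum_(z | _) _; set a := cap w m v.
(* From [a + B < 2 * s], [s <= B] and [m v < (a + 1) * w v], the degree is below
   [(a + 1) * (w v - 1) + 2 * s], where [a + 1 <= s]. *)
nia.
Qed.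

End OneHeavyVertex.

(** * A top-degree class on an odd cycle *)

Section OddCycle.
Local Open Scope nat_scope.
Variables (p : nat) (v : 'I_p.+1).
Hypothesis p_gt0 : 0 < p.
Implicit Types (x y z : 'I_p.+1).

(** The position of [x] counted along the cycle from [v]. *)
Definition offset x := (x + (p.+1 - v)) %% p.+1.

Lemma offset_lt x : offset x < p.+1.
Proof. exact: ltn_pmod. Qed.

Lemma offset_v : offset v = 0.
Proof. by rewrite /offset subnKC ?modnn // ltnW. Qed.

Lemma offset_inj : injective offset.
Proof.
move=> x y /eqP; rewrite /offset eqn_modDr !modn_small // => /eqP.
exact: val_inj.
Qed.

Lemma offset_ordS x :
  offset (ordS x) = if offset x == p then 0 else (offset x).+1.
Proof.
have -> : offset (ordS x) = (offset x).+1 %% p.+1.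
  by rewrite /offset /= modnDml addSn -[in RHS]addn1 modnDml addn1.
case: eqP => [->|/eqP ne_p]; first by rewrite modnn.
by rewrite modn_small // ltn_neqAle eqSS ne_p offset_lt.
Qed.

(** For even [p], the positions 3, 5, ..., [p - 1]. The set stays independent when either [v] or its
    successor is added. *)
Definition far_odd := [set x | odd (offset x) && (1 < offset x)].
Notation F := far_odd.
Notation u := (ordS v).

Lemma offset_ordS_v : offset u = 1.
Proof. by rewrite offset_ordS offset_v; case: eqP => //; lia. Qed.

Lemma offset_eq0 x : (x == v) = (offset x == 0).
Proof. by rewrite -offset_v (inj_eq offset_inj). Qed.

Lemma offset_eq1 x : (x == u) = (offset x == 1).
Proof. by rewrite -offset_ordS_v (inj_eq offset_inj). Qed.

Lemma ordS_v_neq : u != v.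
Proof. by rewrite offset_eq0 offset_ordS_v. Qed.

Lemma v_notin_far_odd : v \notin F.
Proof. by rewrite inE offset_v. Qed.

Lemma ordS_v_notin_far_odd : u \notin F.
Proof. by rewrite inE offset_ordS_v. Qed.

Definition top_supp := v |: (u |: F).

Lemma top_suppD1_ordS_v : top_supp :\ u = v |: F.
Proof.
rewrite /top_supp setUCA setU1K // in_setU1 negb_or ordS_v_neq.
exact: ordS_v_notin_far_odd.
Qed.

Lemma top_suppD1_v : top_supp :\ v = u |: F.
Proof.
by rewrite setU1K // in_setU1 negb_or eq_sym ordS_v_neq; apply: v_notin_far_odd.
Qed.

Variables (w : 'I_p.+1 -> nat) (s : nat).

(* Divided by the product of all variables, this monomial has exponent [-1] on
   [F]; its exponents at [v] and [u] are the largest ones for which inverting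
   [F] and one of [v], [u] does not bring it into the [s]-th power. *)
Definition top_mon : 'X_{1..p.+1} :=
  [multinom if x == v then w v * s else if x == u then s else (x \notin F : nat)
  | x < p.+1].

(** Each vertex other than [v] and [u] counts once, in [F] or as an exponent 1. The denominator has
    degree [p.+1], which leaves [s * (w v).+1] for cohomological plus internal degree. *)
Lemma top_mdeg : #|top_supp| + mdeg top_mon = p.+1 + s * (w v).+1.
Proof.
have sum1 : \sum_(x < p.+1) 1 = p.+1 by rewrite sum1_card card_ord.
rewrite mdegE -sum1_card big_mkcond -big_split /=.
rewrite -[in RHS]sum1 (bigD1 v) //= (bigD1 u) ?ordS_v_neq //=.
rewrite [in RHS](bigD1 v) //= [in RHS](bigD1 u) ?ordS_v_neq //=.
rewrite (eq_bigr (fun=> 1)) => [|x /andP[xv xu]]; last first.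
  by rewrite mnmE /top_supp !in_setU1 (negPf xv) (negPf xu) /=; case: (x \in F).
rewrite !mnmE !in_setU1 !eqxx (negPf ordS_v_neq) orbT /=; lia.
Qed.

Hypothesis p_even : ~~ odd p.

Lemma far_odd_cover y : (y == v) || (y == u) -> vertex_cover (~: (y |: F)).
Proof.
move=> y_vu; apply/forallP => x; rewrite !inE offset_ordS.
have xy : (x == y) = (offset x == offset y) by rewrite (inj_eq offset_inj).
have Sxy : (ordS x == y) = (offset (ordS x) == offset y).
  by rewrite (inj_eq offset_inj).
have := offset_lt x; rewrite xy Sxy offset_ordS.
have -> : offset y = (y == u) :> nat.
  by move: y_vu; rewrite offset_eq0 offset_eq1; case: (offset y) => [|[]].
case: (y == u); case: (offset x =P p) => [->|]; lia.
Qed.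

(** The independent set [v |: F] is maximal: a further vertex is [u], or has an even position and
    its successor is in [F] or is [v]. *)
Lemma top_edge y : y \notin v |: F ->
  exists2 z, z \in y |: (v |: F) & ordS z \in y |: (v |: F).
Proof.
rewrite !inE => /norP[y_v yF].
have [->|y_u] := eqVneq y u; first by exists v; rewrite !inE eqxx ?orbT.
exists y; rewrite !inE ?eqxx // offset_ordS.
apply/orP; right; rewrite offset_eq0 offset_ordS.
move: y_v y_u yF; rewrite offset_eq0 offset_eq1; have := offset_lt y.
by case: (offset y =P p) => [->|] //=; lia.
Qed.

Hypothesis s_gt0 : 0 < s.
Hypothesis w_gt0 : forall x, 0 < w x.
Hypothesis w1 : forall x, x != v -> w x = 1.

(** Both ends of the edge from [top_edge] are inverted, so its [s]-th power is free; the variables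
    not inverted have nonnegative exponents. *)
Lemma top_mon_in y : y \notin v |: F ->
  loc_mono (in_pow w s) (y |: (v |: F)) 1 top_mon.
Proof.
move=> yF; have [z zS SzS] := top_edge yF; set S := y |: _ in zS SzS *.
(* The extra unit in [l] pays for the denominator. *)
pose e := (edge_mon w z *+ s)%MM; pose l := (mdeg e).+1.
exists l, (top_mon + mesym1 S *+ l - mesym1 [set: 'I_p.+1] *+ 1)%MM.
have nS x : x \notin S -> 0 < top_mon x.
  rewrite !inE !negb_or => /and3P[_ xv xF].
  by rewrite mnmE inE (negPf xv) xF; case: eqP.
have inS x : x \in S -> e x < (top_mon + mesym1 S *+ l)%MM x.
  move=> xS; rewrite mnmDE mulmnE [mesym1 S x]mnmE xS mul1n addnC ltn_addr //.
  by rewrite /l ltnS mdegE (bigD1 x) //= leq_addr.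
split; last first.
  rewrite submK //; apply/mnm_lepP => x; rewrite mulmnE mnmE inE.
  have [/inS|/nS] := boolP (x \in S); first by apply: leq_ltn_trans.
  by rewrite mnmDE; apply: ltn_addr.
apply: in_pow_le (in_pow_muln w z s) _; apply/mnm_lepP => x.
rewrite mnmBE mulmnE [mesym1 _ x]mnmE inE.
have [/inS|nxS] := boolP (x \in S); first by rewrite /e mulmnE; lia.
rewrite mnmE; case: eqP => [zx|_]; first by rewrite -zx zS in nxS.
case: eqP => [zx|_]; first by rewrite -zx SzS in nxS.
by rewrite muln0.
Qed.

(** An [x] in [F] keeps exponent -1. If [x] is [v] or [u], the vertices not inverted form a cover
    with exponent 0 except at [x], where the denominator brings the capacity just below [s]. *)
Lemma top_mon_out x : x \in top_supp ->
  ~ loc_mono (in_pow w s) (top_supp :\ x) 1 top_mon.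
Proof.
move=> xT [l [m [m_in mE]]].
have mz z : z \notin top_supp :\ x -> top_mon z = m z + 1.
  move=> zS; have := congr1 (fun m : 'X_{1..p.+1} => m z) mE.
  rewrite /= !mnmDE !mulmnE [mesym1 (_ :\ _) z]mnmE [mesym1 setT z]mnmE.
  by rewrite in_setT (negPf zS) addn0.
have [xF|nxF] := boolP (x \in F).
  have := mz x; rewrite in_setD1 eqxx => /(_ isT); rewrite mnmE xF.
  have [xv|_] := eqVneq x v; first by have := v_notin_far_odd; rewrite -xv xF.
  have [xu|_] := eqVneq x u.
    by have := ordS_v_notin_far_odd; rewrite -xu xF.
  by rewrite addn1.
have x_vu : (x == v) || (x == u).
  by move: xT; rewrite !in_setU1 (negPf nxF) orbF.
have cov : vertex_cover (~: (top_supp :\ x)).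
  case/orP: x_vu => /eqP->; rewrite ?top_suppD1_v ?top_suppD1_ordS_v.
    by apply: far_odd_cover; rewrite eqxx orbT.
  by apply: far_odd_cover; rewrite eqxx.
have := in_pow_cover w_gt0 cov m_in; apply/negP; rewrite -ltnNge.
have nxS : x \notin top_supp :\ x by rewrite !inE eqxx.
rewrite (bigD1 x) ?in_setC //= big1 ?addn0 => [|z /andP[zS zx]].
  rewrite ltn_divLR // -(ltn_add2r 1) -mz // addn1 ltnS mnmE.
  case/orP: x_vu => [/eqP->|/eqP->]; first by rewrite eqxx mulnC.
  by rewrite (negPf ordS_v_neq) eqxx w1 ?ordS_v_neq // muln1.
rewrite in_setC in zS; have := mz z zS.
move: zS; rewrite !in_setD1 zx /= !in_setU1 !negb_or => /and3P[zv zu zF].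
rewrite mnmE (negPf zv) (negPf zu) zF => mz1.
have m0 : m z = 0 by lia.
by rewrite /cap m0 div0n.
Qed.

End OddCycle.
Theorem corollary4p5 (K : fieldType) (n : nat) (hn : (1 <= n)%N)
    (D : wograph 'I_(2 * n).+1) (hcycle : underlying_cycle D)
    (hsink : forall x, x \in Vplus D -> is_sink D x)
    (v : 'I_(2 * n).+1) (hv : Vplus D = [set v])
    (s : nat) (hs : (1 <= s)%N) :
  exists r : int,
    is_reg (symbolic_power (edge_ideal K D) s) r /\
    is_reg (ideal_pow (edge_ideal K D) s) r.
Proof.
set p := (2 * n)%N in D hcycle hsink v hv *.
have p_gt0 : (0 < p)%N by rewrite /p; lia.
have p_even : ~~ odd p by rewrite /p; lia.
have w_gt0 := weight_gt0 D.
have w1 x : x != v -> weight D x = 1%N.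
  by move=> ne_xv; apply/eqP; move: ne_xv; rewrite -in_set1 -hv inE negbK.
have tail_weight x y : Defs.arc D x y -> weight D x = 1%N.
  move=> xy; apply/eqP/negPn/negP => wx.
  by have := hsink x; rewrite inE => /(_ wx y); rewrite xy.
pose A := in_pow (weight D) s; pose J := @mono_ideal K p.+1 A.
have upA m d : A m -> A (m + d)%MM by apply: in_powD.
have JP f : ideal_pow (edge_ideal K D) s f <-> J f.
  exact: ideal_powP.
have lcP i j : lc_neq0 (ideal_pow (edge_ideal K D) s) i j <-> lc_neq0 J i j.
  have pieceP S u : loc_piece (ideal_pow (edge_ideal K D) s) S j u <->
      loc_piece J S j u.
    by split; apply: loc_piece_sub => f /JP.
  split=> -[c [c_in c_cyc c_ncob]]; exists c; split=> // [S Si|[b [b_in bE]]].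
  - exact/pieceP/c_in.
  - by apply: c_ncob; exists b; split=> // S Si; apply/pieceP/b_in.
  - exact/pieceP/c_in.
  by apply: c_ncob; exists b; split=> // S Si; apply/pieceP/b_in.
(* Membership in the [s]-th power depends only on exponents cut at [s * W], which bounds all
   internal degrees. *)
pose W := (\max_x (weight D x).*2)%N.
apply: (@common_reg K p.+1 _ _ (ideal_pow_ideal _ _) _ _
  (p.+1 * (s * W))%:Z (s * (weight D v).+1)%:Z
  #|top_supp v| ((mdeg (top_mon v (weight D) s))%:Z - (1 * p.+1)%:Z)) => //.
- exact: ideal_pow_symbolic.
- by move=> f x; apply: symbolic_power_saturated.
- move=> i j /lcP Hij; apply: ltW; apply: (lc_mono_bounded upA _ _ Hij) => //.
  move=> m m'; apply: in_pow_trunc => z; exact: (leq_bigmax z).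
- move=> j /lcP /(lc_mono_one upA) []; first by rewrite ltnS.
  move=> m [nAm <- satm].
  by have := in_pow_saturated_mdeg p_gt0 w_gt0 w1 nAm satm; lia.
- have := max_card (mem (top_supp v)); rewrite card_ord => ->; rewrite andbT.
  rewrite /top_supp !cardsU1 in_setU1 negb_or eq_sym ordS_v_neq //.
  by rewrite v_notin_far_odd ordS_v_notin_far_odd.
- apply/lcP; apply: (@lc_mono_neq0 K p.+1 A upA _ (ordS v)).
  + by rewrite /top_supp !inE eqxx orbT.
  + by move=> y; rewrite top_suppD1_ordS_v //; apply: top_mon_in.
  + by move=> x; apply: top_mon_out.
have := top_mdeg v p_gt0 (weight D) s; lia.
Qed.
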